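(* Let $A \in \mathcal M_d(\mathbb R)$ satisfy $\rho(A) < 1$ and let $\lambda$ satisfy the regularity assumption stated in the context. Then there exist positive constants $C$ and $\gamma$ such that, for every classical solution $u \in C^0(\mathbb R_+ \times [0, 1], \mathbb R^d) \cap C^1(\mathbb R_+^\ast \times (0, 1), \mathbb R^d)$ of $$\left\{\begin{aligned} & \partial_t u(t, x) + \lambda(t, x) \partial_x u(t, x) = 0, & \quad & t > 0,\ x \in (0, 1), \\ & u(t, 0) = A u(t, 1), & & t \geq 0, \\ & u(0, x) = u_0(x), & & x \in [0, 1], \end{aligned}\right. \tag{T}$$ with initial condition $u_0$, we have $$\lVert u(t, \cdot)\rVert_{L^\infty([0, 1], \mathbb R^d)} \leq C e^{-\gamma t} \lVert u_0\rVert_{L^\infty([0, 1], \mathbb R^d)} \qquad \text{for every } t \in \mathbb R_+.$$ Moreover, let $\alpha \in (0, 1)$ be the constant from the context (so that $\tau'(t) \leq \alpha$ for every $t \in \mathbb R$), let $p \in [1, +\infty)$, and assume that $\rho(A)^p < 1 - \alpha$. Then there exist positive constants $C$ and $\gamma$ such that, for every classical solution $u \in C^0(\mathbb R_+ \times [0, 1], \mathbb R^d) \cap C^1(\mathbb R_+^\ast \times (0, 1), \mathbb R^d)$ of (T) with initial condition $u_0$, we have $$\lVert u(t, \cdot)\rVert_{L^p([0, 1], \mathbb R^d)} \leq C e^{-\gamma t} \lVert u_0\rVert_{L^p([0, 1], \mathbb R^d)} \qquad \text{for every } t \in \mathbb R_+.$$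
   Context: $\mathbb R_+ = [0, +\infty)$, $\mathbb R_+^\ast = (0, +\infty)$; $\mathcal M_d(\mathbb R)$ is the set of real $d \times d$ matrices, $d$ a positive integer, and $\rho(A)$ is the spectral radius of $A$. Assumption on $\lambda$: there exist positive constants $\lambda_{\min} \leq \lambda_{\max}$ and $L$ such that $\lambda \in C^0(\mathbb R^2, [\lambda_{\min}, \lambda_{\max}])$, $\lambda = \lambda(t,x)$ is differentiable with respect to its second variable $x$, and $\partial_x \lambda \in C^0(\mathbb R^2, [-L, L])$. The flow of $\lambda$ is the unique function $\Phi \in C^1(\mathbb R^3, \mathbb R)$ with $\partial_t \Phi(t, t_0, x_0) = \lambda(t, \Phi(t, t_0, x_0))$ and $\Phi(t_0, t_0, x_0) = x_0$ for all $(t, t_0, x_0) \in \mathbb R^3$. For $(t, x) \in \mathbb R^2$, $R(t, x)$ is the unique real number with $\Phi(R(t, x), t, x) = 0$; $R \in C^1(\mathbb R^2, \mathbb R)$. The function $\tau\colon \mathbb R \to \mathbb R$ is $\tau(t) = t - R(t, 1)$; it is $C^1$, and there exists a constant $\alpha \in (0, 1)$ such that $\tau'(t) \leq \alpha$ for every $t \in \mathbb R$; $\alpha$ denotes such a constant. A \emph{classical solution} of (T) with initial condition $u_0\colon [0,1] \to \mathbb R^d$ is a function $u \in C^0(\mathbb R_+ \times [0, 1], \mathbb R^d) \cap C^1(\mathbb R_+^\ast \times (0, 1), \mathbb R^d)$ satisfying the three equalities of (T) in their respective domains. *)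

(* Defs.v *)
From HB Require Import structures.
From mathcomp Require Import all_boot all_order all_algebra.
From mathcomp Require Import all_classical all_reals all_analysis.
From mathcomp Require Import complex.

Set Implicit Arguments.
Unset Strict Implicit.
Unset Printing Implicit Defensive.

Import Order.TTheory GRing.Theory Num.Theory.
Import numFieldNormedType.Exports.

Local Open Scope classical_set_scope.
Local Open Scope ring_scope.

(* The eigenvalues are the complex ones: A is first mapped into the
   matrices over R[i]. For 0 < d the set below is finite and nonempty. *)
Definition spectral_radius (R : realType) (d : nat) (A : 'M[R]_d) : R :=
  sup [set r : R | exists z : R[i],
    eigenvalue (map_mx (fun a : R => a%:C%C) A) z /\
    `|z| = r%:C%C].

Definition is_norm (R : realType) (d : nat) (N : 'cV[R]_d -> R) : Prop :=
  [/\ forall v, N v = 0 -> v = 0,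
      forall a v, N (a *: v) = `|a| * N v
    & forall v w, N (v + w) <= N v + N w].

(* Meant for an open set U, so that the differential of f at the points of U
   only depends on the restriction of f to U. *)
Definition C1_on (R : realType) (V W : normedModType R) (U : set V)
    (f : V -> W) : Prop :=
  (forall x, U x -> differentiable f x) /\
  (forall v x, U x -> {for x, continuous (fun y => 'd f y v)}).

Definition lambda_regular (R : realType) (lambda : R * R -> R) : Prop :=
  exists lmin lmax L : R,
    [/\ 0 < lmin, lmin <= lmax & 0 < L] /\
    [/\ continuous lambda,
        forall p, lmin <= lambda p <= lmax,
        forall t x, derivable (fun y => lambda (t, y)) x 1,
        continuous (fun p : R * R => derive1 (fun y => lambda (p.1, y)) p.2)
      & forall t x, - L <= derive1 (fun y => lambda (t, y)) x <= L].

Definition is_flow (R : realType) (lambda : R * R -> R)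
    (Phi : R * R * R -> R) : Prop :=
  [/\ C1_on setT Phi,
      forall t t0 x0 : R,
        derive1 (fun s => Phi (s, t0, x0)) t = lambda (t, Phi (t, t0, x0))
    & forall t0 x0 : R, Phi (t0, t0, x0) = x0].

(* Rt (t, x) is the unique zero of s |-> Phi (s, t, x). *)
Definition is_origin_time (R : realType) (Phi : R * R * R -> R)
    (Rt : R * R -> R) : Prop :=
  forall t x s : R, Phi (s, t, x) = 0 <-> s = Rt (t, x).

Definition delay (R : realType) (Rt : R * R -> R) (t : R) : R :=
  t - Rt (t, 1).

(* u is only meaningful on [0, +oo[ * [0, 1] and u0 on [0, 1]: their values
   elsewhere are unconstrained. *)
Definition classical_solution (R : realType) (d : nat) (A : 'M[R]_d)
    (lambda : R * R -> R) (u0 : R -> 'cV[R]_d) (u : R * R -> 'cV[R]_d) : Prop :=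
  [/\ {within [set p : R * R | 0 <= p.1 /\ 0 <= p.2 <= 1], continuous u},
      C1_on [set p : R * R | 0 < p.1 /\ 0 < p.2 < 1] u,
      forall t x : R, 0 < t -> 0 < x < 1 ->
        derive1 (fun s => u (s, x)) t
          + lambda (t, x) *: derive1 (fun y => u (t, y)) x = 0,
      forall t : R, 0 <= t -> u (t, 0) = A *m u (t, 1)
    & forall x : R, 0 <= x <= 1 -> u (0, x) = u0 x].

(* The norm of L^p([0, 1], R^d), 1 <= p <= +oo, where R^d carries the norm N;
   v is extended by zero outside [0, 1]. *)
Definition Lp_norm01 (R : realType) (d : nat) (N : 'cV[R]_d -> R) (p : \bar R)
    (v : R -> 'cV[R]_d) : \bar R :=
  ('N[@lebesgue_measure R]_p[EFin \o ((N \o v) \_ `[0%R, 1%R])])%E.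

(* Main.v *)
(* For every q > rho(A) there is a positive definite quadratic form Q with
   Q(A v) <= q^2 Q(v).

   L^oo: choose q < 1. For suitable gamma, mu > 0 the function
   z = e^(gamma t - mu x) Q(u) satisfies z_t + lambda z_x <= 0 and z(t, 0) <= q z(t, 1),
   so by the maximum principle z is bounded by its initial values.

   L^p: let y(s) be the value of u on the characteristic leaving x = 0 at time s, and
   h(t) = Rt(t, 1) = t - delay(t). Then y(t) = A y(h(t)), and with q^p < 1 - alpha <= h' the
   energy E(t) = int_(h(t))^t e^(gamma s) Q(y(s))^(p/2) ds is nonincreasing for small
   gamma > 0. The change of variables x = Phi(t, s, 0), whose Jacobian is bounded above and
   below by Gronwall's lemma, compares e^(- gamma t) E(t) with the p-th power of the L^p norm
   of u(t, .). *)
Require Import Defs.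
From HB Require Import structures.
From mathcomp Require Import all_boot all_order all_algebra.
From mathcomp Require Import all_classical all_reals all_analysis.
From mathcomp Require Import ess_sup_inf complex ring lra.
Import Order.TTheory GRing.Theory Num.Theory.
Import numFieldNormedType.Exports.
Local Open Scope classical_set_scope.
Local Open Scope ring_scope.

Set Implicit Arguments.
Unset Strict Implicit.
Unset Printing Implicit Defensive.

(** * A quadratic form contracted by A *)

(** A classical solution is differentiable only in the open strip and merely continuous up to its
    sides, so nothing may be differentiated at x = 0, x = 1 or t = 0; the maximum principle and the
    transport along characteristics are arranged to use continuity alone there. The norm N is
    arbitrary, in general neither differentiable nor contracted by A. A quadratic form is smooth, so
    the transport equation passes from u to Q(u), and compactness of the unit sphere makes sqrt(Q)
    comparable with N; no constant depends on u. In the L^p part y is only continuous. Therefore E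
    is written as P(t) - P(h(t)) with an antiderivative P of the integrand, whose derivative is
    explicit once h is known to be differentiable. All other integrals are likewise increments of
    antiderivatives: the change of variables and the integral inequalities become comparisons of
    derivatives. *)

Section SpectralRadius.
Variables (R : realType) (d : nat) (A : 'M[R]_d).
Hypothesis d_gt0 : (0 < d)%N.
Local Notation AC := (map_mx (fun a : R => a%:C%C) A).

Lemma normc_normE (z : R[i]) : `|z| = (ComplexField.Normc.normc z)%:C%C.
Proof. by rewrite normc_def; case: z. Qed.

Lemma char_poly_splits : exists s : d.-tuple R[i],
  char_poly AC = \prod_(z <- s) ('X - z%:P).
Proof.
have [s hs] := closed_field_poly_normal (char_poly AC).
have sz : size s == d.
  have := size_char_poly AC; rewrite hs size_scale ?size_prod_XsubC; last first.
    by rewrite (monicP (char_poly_monic AC)) oner_neq0.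
  by move=> /eqP; rewrite eqSS.
exists (Tuple sz); rewrite /= {1}hs (monicP (char_poly_monic AC)) scale1r //.
Qed.

Lemma spectral_radius_ub (z : R[i]) :
  root (char_poly AC) z -> ComplexField.Normc.normc z <= spectral_radius A.
Proof.
move=> rz; apply: ub_le_sup; last first.
  by exists z; rewrite eigenvalue_root_char rz normc_normE.
have [s hs] := char_poly_splits.
(* The supremum is an upper bound only if the set has one; the sum of all moduli serves. *)
exists (\sum_(z <- s) ComplexField.Normc.normc z) => r [w []].
rewrite eigenvalue_root_char hs root_prod_XsubC => ws.
rewrite normc_normE => -[<-].
by rewrite (big_rem _ ws)/= lerDl sumr_ge0// => i _; case: i => ? ?; rewrite sqrtr_ge0.
Qed.

Lemma spectral_radius_ge0 : 0 <= spectral_radius A.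
Proof.
have [s hs] := char_poly_splits.
have zs : tnth s (Ordinal d_gt0) \in (s : seq _) by exact: mem_tnth.
apply: le_trans (@spectral_radius_ub (tnth s (Ordinal d_gt0)) _).
  by case: (tnth _ _) => ? ?; rewrite sqrtr_ge0.
by rewrite hs root_prod_XsubC.
Qed.
End SpectralRadius.

(** Convexity of the square with weights rho and e: the defect is rho e (b - c)^2 for the moduli b
    of x and c of y. It is applied to each entry of B_k A = e B_(k+1) + s_k B_k. *)
Lemma normc_sqr_convex (R : realType) (s x y : R[i]) (rho e : R) :
  0 <= rho -> 0 < e -> ComplexField.Normc.normc s <= rho ->
  ComplexField.Normc.normc (e%:C%C * y + s * x) ^+ 2 <=
  (rho + e) * (rho * ComplexField.Normc.normc x ^+ 2 + e * ComplexField.Normc.normc y ^+ 2).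
Proof.
move=> rho0 e0 srho.
have n0 (z : R[i]) : 0 <= ComplexField.Normc.normc z by case: z => ? ?; rewrite sqrtr_ge0.
have : ComplexField.Normc.normc (e%:C%C * y + s * x) <=
    rho * ComplexField.Normc.normc x + e * ComplexField.Normc.normc y.
  apply: (@le_trans _ _ (ComplexField.Normc.normc (e%:C%C * y) + ComplexField.Normc.normc (s * x))).
    by rewrite -lecR rmorphD/= -!normc_normE ler_normD.
  rewrite !ComplexField.Normc.normcM addrC lerD// ?ler_wpM2r//.
  by rewrite /= expr0n/= addr0 sqrtr_sqr gtr0_norm.
move=> h; have := n0 x; have := n0 y; have := n0 (e%:C%C * y + s * x).
move: h; set a := ComplexField.Normc.normc _; set b := ComplexField.Normc.normc _.
set c := ComplexField.Normc.normc _ => h a0 c0 b0.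
apply: (@le_trans _ _ ((rho * b + e * c) ^+ 2)); first by rewrite ler_sqr ?nnegrE// (le_trans a0).
have -> : (rho + e) * (rho * b ^+ 2 + e * c ^+ 2) =
  (rho * b + e * c) ^+ 2 + rho * e * (b - c) ^+ 2 by ring.
by rewrite lerDl mulr_ge0 ?sqr_ge0// mulr_ge0// ltW.
Qed.

(** A quadratic form presented as a sum of squares of linear functionals, so that nonnegativity,
    homogeneity and smoothness can be read off. *)
Definition sumsq (R : realType) (d : nat) (I : finType) (r : I -> 'rV[R]_d)
  (v : 'cV[R]_d) : R := \sum_i ((r i *m v) 0 0) ^+ 2.

(* With [s] the eigenvalues, B_0 = 1 and B_(k+1) = c B_k (A - s_k) one has
   B_k A = e B_(k+1) + s_k B_k with e = 1/c = q - rho, and B_d = 0 by Cayley-Hamilton;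
   the form is the sum over k < d of |B_k v|^2, split into real and imaginary parts. *)
Lemma adapted_form (R : realType) (d : nat) (A : 'M[R]_d) (q : R) : (0 < d)%N ->
  spectral_radius A < q ->
  exists (I : finType) (r : I -> 'rV[R]_d),
   (forall v, sumsq r v = 0 -> v = 0) /\
   forall v, sumsq r (A *m v) <= q ^+ 2 * sumsq r v.
Proof.
case: d A => // d A _ rq.
set rho := spectral_radius A in rq.
have rho0 : 0 <= rho by exact: spectral_radius_ge0.
set AC := map_mx (fun a : R => a%:C%C) A.
have [s hs] := char_poly_splits A.
pose e := q - rho.
have e0 : 0 < e by rewrite subr_gt0.
pose c : R[i] := (e^-1)%:C%C.
have ce : c * e%:C%C = 1.
  by rewrite /c -rmorphM/= mulVf ?gt_eqF.
pose B := fix B k : 'M[R[i]]_d.+1 :=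
  if k is k'.+1 then c *: (B k' *m (AC - (s`_k')%:M)) else 1%:M.
have BA k : B k *m AC = e%:C%C *: B k.+1 + s`_k *: B k.
  rewrite /= scalerA mulrC ce scale1r mulmxBr mul_mx_scalar; by rewrite subrK.
have Bd : B d.+1 = 0.
  have H k : (k <= d.+1)%N -> B k = c ^+ k *: horner_mx AC (\prod_(z <- take k s) ('X - z%:P)).
    elim: k => [_|k IH kd]; first by rewrite take0 big_nil rmorph1 expr0 scale1r.
    rewrite (take_nth 0) ?size_tuple// -cats1 big_cat/= big_seq1 rmorphM/= rmorphB/=.
    rewrite horner_mx_X horner_mx_C IH ?(ltnW kd)// -scalemxAl scalerA -exprS//.
  have := H d.+1 (leqnn _).
  by rewrite take_oversize ?size_tuple// -hs Cayley_Hamilton scaler0.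
pose I := ('I_d.+1 * 'I_d.+1 * bool)%type.
pose r (i : I) : 'rV[R]_d.+1 :=
  \row_l (if i.2 then complex.Re (B i.1.1 i.1.2 l) else complex.Im (B i.1.1 i.1.2 l)).
pose toC := map_mx (fun a : R => a%:C%C) : 'cV[R]_d.+1 -> 'cV[R[i]]_d.+1.
pose N2 (w : 'cV[R[i]]_d.+1) : R := \sum_j (ComplexField.Normc.normc (w j 0)) ^+ 2.
have sE v : sumsq r v = \sum_(k < d.+1) N2 (B k *m toC v).
  rewrite /sumsq pair_big/=.
  rewrite -(pair_bigA _ (fun (p : 'I_d.+1 * 'I_d.+1) b => ((r (p, b) *m v) 0 0) ^+ 2))/=.
  apply: eq_bigr => -[k j] _ /=.
  rewrite big_bool/=.
  have -> : (B k *m toC v) j 0 = ((r (k, j, true) *m v) 0 0 +i* (r (k, j, false) *m v) 0 0)%C.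
    rewrite !mxE; under eq_bigr do rewrite mxE.
    have sumC (F : 'I_d.+1 -> R[i]) :
        \sum_i F i = ((\sum_i complex.Re (F i)) +i* (\sum_i complex.Im (F i)))%C.
      by elim/big_rec3 : _ => // i x y z _ ->; case: (F i).
    rewrite sumC; congr (_ +i* _)%C; apply: eq_bigr => i _; rewrite !mxE/=;
      by case: (B k j i) => a b /=; ring.
  rewrite /= sqr_sqrtr//; by rewrite addr_ge0 ?sqr_ge0.
exists I, r; split.
  move=> v; rewrite sE => /eqP; rewrite psumr_eq0; last first.
    by move=> k _; apply: sumr_ge0 => j _; rewrite sqr_ge0.
  (* Since [B 0] is the identity, the term k = 0 is the squared length of v, and this gives
     definiteness. *)
  move=> /allP /(_ ord0 (mem_index_enum _))/=.
  rewrite mul1mx psumr_eq0; last by move=> j _; rewrite sqr_ge0.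
  move=> /allP h; apply/matrixP => i j; rewrite (ord1 j) mxE.
  have := h i (mem_index_enum _); rewrite implyTb sqrf_eq0 mxE => /eqP.
  by move=> /ComplexField.Normc.eq0_normc [].
move=> v; rewrite !sE.
have -> : toC (A *m v) = AC *m toC v by rewrite /toC map_mxM.
have step k : (k < d.+1)%N -> N2 (B k *m (AC *m toC v)) <=
    q * (rho * N2 (B k *m toC v) + e * N2 (B k.+1 *m toC v)).
  move=> kd; rewrite mulmxA BA mulmxDl -!scalemxAl.
  rewrite /N2 !mulr_sumr -big_split/= mulr_sumr; apply: ler_sum => j _.
  have addE (a b : R[i]) (U V : 'cV[R[i]]_d.+1) :
      (a *: U + b *: V) j 0 = a * U j 0 + b * V j 0 by rewrite !mxE.
  rewrite addE.
  have -> : q = rho + e by rewrite /e addrC subrK.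
  apply: normc_sqr_convex => //.
  apply: spectral_radius_ub; rewrite hs root_prod_XsubC mem_nth ?size_tuple//.
have : \sum_(k < d.+1) N2 (B k *m (AC *m toC v)) <=
   \sum_(k < d.+1) q * (rho * N2 (B k *m toC v) + e * N2 (B k.+1 *m toC v)).
  by apply: ler_sum => k _; exact: step.
move=> /le_trans; apply.
rewrite -mulr_sumr big_split/= -!mulr_sumr.
rewrite expr2 -mulrA ler_wpM2l//; first exact: le_trans (ltW rq).
have N20 w : 0 <= N2 w by apply: sumr_ge0 => j _; rewrite sqr_ge0.
(* Shifting the index drops the nonnegative term k = 0 and adds the term of [B d.+1], which is zero;
   the total factor is then q (rho + e) = q^2. *)
have : \sum_(i < d.+1) N2 (B i.+1 *m toC v) <= \sum_(k < d.+1) N2 (B k *m toC v).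
  rewrite big_ord_recr/= -/(B d.+1) Bd mul0mx.
  rewrite [leRHS]big_ord_recl/= /bump/=.
  have -> : N2 0 = 0 by rewrite /N2 big1// => j _; rewrite mxE/= expr0n/= addr0 sqrtr0 expr0n.
  by rewrite addr0 lerDr.
move=> /(ler_wpM2l (ltW e0)) h.
apply: (le_trans (lerD (lexx _) h)).
by rewrite -mulrDl /e addrC subrK.
Qed.

Lemma differentiable_bigsum (R : numFieldType) (V W : normedModType R) (I : Type)
    (s : seq I) (f : I -> V -> W) (x : V) :
  (forall i, differentiable (f i) x) ->
  differentiable (fun v => \sum_(i <- s) f i v) x.
Proof.
move=> df; elim: s => [|i s IH].
  under eq_fun do rewrite big_nil; exact: differentiable_cst.
under eq_fun do rewrite big_cons; exact: differentiableD.
Qed.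

Lemma differentiable_sumsq (R : realType) (d : nat) (I : finType)
    (r : I -> 'rV[R]_d) (v : 'cV[R]_d) : differentiable (sumsq r) v.
Proof.
apply: differentiable_bigsum => i.
have dr : differentiable (fun w => (r i *m w) 0 0) v.
  under eq_fun do rewrite mxE.
  apply: differentiable_bigsum => j.
  apply: (@differentiableM _ _ (cst (r i 0 j)) (fun w : 'cV[R]_d => w j 0)).
    exact: differentiable_cst.
  exact: differentiable_coord.
exact: (@differentiableX _ _ (fun w : 'cV[R]_d => (r i *m w) 0 0) 1 v dr).
Qed.

Lemma continuous_sumsq (R : realType) (d : nat) (I : finType)
    (r : I -> 'rV[R]_d) : continuous (sumsq r).
Proof. by move=> v; apply: differentiable_continuous; exact: differentiable_sumsq. Qed.

Lemma sumsq_ge0 (R : realType) (d : nat) (I : finType)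
    (r : I -> 'rV[R]_d) v : 0 <= sumsq r v.
Proof. by apply: sumr_ge0 => i _; exact: sqr_ge0. Qed.

Lemma sumsqZ (R : realType) (d : nat) (I : finType)
    (r : I -> 'rV[R]_d) (a : R) v : sumsq r (a *: v) = a ^+ 2 * sumsq r v.
Proof.
by rewrite /sumsq mulr_sumr; apply: eq_bigr => i _; rewrite -scalemxAr mxE exprMn.
Qed.

(** * Comparison of homogeneous functions with a norm *)

Section NormEquivalence.
Variables (R : realType) (d : nat).
Implicit Types (G N : 'cV[R]_d -> R) (v w : 'cV[R]_d).

(** Nonnegativity is not among the axioms of [is_norm]; it follows from 0 = N (v - v) <= N v + N (-
    v) = 2 N v. *)
Lemma is_norm_ge0 N : is_norm N -> forall v, 0 <= N v.
Proof.
move=> [_ NZ ND] v; have := ND v (- v).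
have -> : N (- v) = N v by rewrite -scaleN1r NZ normrN1 mul1r.
have -> : N (v - v) = 0 by rewrite subrr -(scale0r 0) NZ normr0 mul0r.
by rewrite -mulr2n pmulrn_lge0.
Qed.

Lemma is_norm_sum N : is_norm N ->
  forall v, N v <= \sum_j `|v j 0| * N (delta_mx j 0).
Proof.
move=> [N0 NZ ND] v; rewrite {1}(matrix_sum_delta v).
have N00 : N 0 = 0 by rewrite -(scale0r 0) NZ normr0 mul0r.
apply: (@le_trans _ _ (\sum_j N (\sum_(j0 < 1) v j j0 *: delta_mx j j0))).
  elim/big_ind2 : _ => [|a b c e ab ce|//]; first by rewrite N00.
  by apply: le_trans (ND _ _) _; exact: lerD.
by apply: ler_sum => j _; rewrite big_ord1 NZ.
Qed.

Lemma is_norm_continuous N : is_norm N -> continuous N.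
Proof.
move=> NN v; have [N0 NZ ND] := NN; apply/(@cvgrPdist_le _ _ _ (nbhs v) (nbhs_filter v)) => e e0.
(* A Lipschitz constant with respect to the maximum norm; the summand 1 makes it positive. *)
pose K := 1 + \sum_j N (delta_mx j 0).
have K0 : 0 < K by rewrite ltr_wpDr// sumr_ge0// => j _; exact: is_norm_ge0.
have NK w : N w <= K * `|w|.
  apply: le_trans (is_norm_sum NN w) _.
  apply: (@le_trans _ _ (\sum_j `|w| * N (delta_mx j 0))).
    apply: ler_sum => j _; apply: ler_wpM2r; first exact: is_norm_ge0.
    rewrite [leRHS]/Num.norm /= mx_normrE; apply/bigmax_geP; right => /=.
    by exists (j, 0).
  by rewrite -mulr_sumr mulrC ler_wpM2r// /K lerDr.
have Nsym w w' : N (w - w') = N (w' - w) by rewrite -opprB -scaleN1r NZ normrN1 mul1r.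
near=> w.
have hw : N (v - w) <= e.
  apply: le_trans (NK _) _; rewrite -ler_pdivlMl//.
  near: w.
  have /(@cvgrPdist_le _ _ _ (nbhs v) (nbhs_filter v)) : (w @[w --> v] --> v) by exact: cvg_id.
  by apply; rewrite mulr_gt0 ?invr_gt0.
apply: le_trans hw; rewrite ler_norml; apply/andP; split.
  rewrite lerBrDl lerBlDr Nsym.
  by apply: le_trans (ND _ _); rewrite subrKC.
by rewrite lerBlDr; apply: le_trans (ND _ _); rewrite subrK.
Unshelve. all: by end_near. Qed.

(** Both functions are compared with the maximum norm: on its compact unit sphere each has a
    positive minimum and a maximum, and homogeneity extends the bounds to all vectors. No triangle
    inequality is asked of [G], so the square root of a quadratic form qualifies directly. *)
Lemma homogeneous_equiv G N : (0 < d)%N -> is_norm N ->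
  continuous G -> (forall v, 0 <= G v) ->
  (forall a v, G (a *: v) = `|a| * G v) -> (forall v, G v = 0 -> v = 0) ->
  exists c C, [/\ 0 < c, 0 < C & forall v, c * N v <= G v <= C * N v].
Proof.
move=> d0 NN cG G0 GZ Gd; have [N0 NZ ND] := NN.
(* Compactness is used for row vectors, hence the transposes. *)
have trc : continuous (trmx : 'rV[R]_d -> 'cV[R]_d).
  move=> x U /nbhs_ballP [e e0 eU]; apply/nbhs_ballP; exists e => // y [_ h].
  by apply: eU; split => // i j; rewrite !mxE.
pose S := [set v : 'rV[R]_d | `|v| = 1].
have cS : compact S.
  apply: bounded_closed_compact.
    by exists 1; split => // M M1 v /= ->; exact: ltW.
  have -> : S = (fun v : 'rV[R]_d => `|v|) @^-1` [set 1] by [].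
  apply: closed_comp; last exact: closed_eq.
  by move=> *; exact: norm_continuous.
have S0 : S !=set0.
  pose v : 'rV[R]_d := const_mx 1.
  have v0 : v != 0.
    apply/eqP => /matrixP/(_ 0 (Ordinal d0)); rewrite !mxE; exact/eqP/oner_neq0.
  by exists (`|v|^-1 *: v); rewrite /S/= normrZ normfV normr_id mulVf ?normr_eq0.
have key (F : 'cV[R]_d -> R) : continuous F -> (forall v, 0 <= F v) ->
    (forall a v, F (a *: v) = `|a| * F v) ->
    (forall v, F v = 0 -> v = 0) ->
    exists c C, [/\ 0 < c, 0 < C & forall v, c * `|v^T| <= F v <= C * `|v^T|].
  move=> cF F0 FZ Fd.
  have cFt : {within S, continuous (F \o trmx)}.
    apply: continuous_subspaceT => x; apply: continuous_comp; [exact: trc|exact: cF].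
  have [cm] := EVT_min_rV S0 cS cFt; rewrite inE => Scm hm.
  have [cM] := EVT_max_rV S0 cS cFt; rewrite inE => ScM hM.
  have Fp (w : 'rV[R]_d) : S w -> 0 < F w^T.
    move=> Sw; rewrite lt0r F0 andbT; apply/eqP => /Fd/(congr1 trmx).
    rewrite trmxK trmx0 => w0; move: Sw; rewrite /S/= w0 normr0 => /esym/eqP.
    by rewrite oner_eq0.
  exists (F cm^T), (F cM^T); split; [exact: Fp|exact: Fp|].
  move=> v; have [->|v0] := eqVneq v 0.
    have F00 : F 0 = 0 by have := FZ 0 0; rewrite scale0r normr0 mul0r.
    by rewrite trmx0 normr0 !mulr0 F00 lexx.
  have n0 : 0 < `|v^T|.
    rewrite normr_gt0; apply: contra_neq v0 => /(congr1 trmx).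
    by rewrite trmxK trmx0.
  have Sv : S (`|v^T|^-1 *: v^T).
    by rewrite /S/= normrZ normfV normr_id mulVf// gt_eqF.
  have := hm _ (mem_set Sv); have := hM _ (mem_set Sv).
  rewrite /= linearZ/= trmxK FZ ger0_norm; last by rewrite invr_ge0.
  by rewrite ler_pdivrMl // ler_pdivlMl // mulrC (mulrC `|_|) => -> ->.
have [c1 [C1 [c10 C10 H1]]] := key _ cG G0 GZ Gd.
have [c2 [C2 [c20 C20 H2]]] := key _ (is_norm_continuous NN) (is_norm_ge0 NN) NZ N0.
exists (c1 / C2), (C1 / c2); split; [exact: divr_gt0|exact: divr_gt0|] => v.
have /andP[a1 b1] := H1 v; have /andP[a2 b2] := H2 v.
apply/andP; split.
  rewrite mulrAC ler_pdivrMr//; apply: (@le_trans _ _ (c1 * (C2 * `|v^T|))).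
    by rewrite ler_pM2l.
  by rewrite mulrCA mulrC ler_pM2r.
apply: (le_trans b1); rewrite -mulrA ler_pM2l// ler_pdivlMl//.
Unshelve. all: by end_near. Qed.
End NormEquivalence.

(** * The maximum principle and decay in the supremum norm *)

Lemma continuous_curry_snd (T1 T2 T3 : topologicalType) (G : T1 * T2 -> T3) (t : T1) :
  continuous G -> continuous (fun y => G (t, y)).
Proof.
move=> cG y; apply: (@continuous_comp _ _ _ (fun y => (t, y)) G); last exact: cG.
by apply: cvg_pair; [exact: cvg_cst|exact: cvg_id].
Qed.

Lemma continuous_curry_fst (T1 T2 T3 : topologicalType) (G : T1 * T2 -> T3) (y : T2) :
  continuous G -> continuous (fun t => G (t, y)).
Proof.
move=> cG t; apply: (@continuous_comp _ _ _ (fun t => (t, y)) G); last exact: cG.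
by apply: cvg_pair; [exact: cvg_id|exact: cvg_cst].
Qed.

(** Serves both variables of (G - K)(T - t)(1 - x): [T] is the end time or 1, and [c] is the factor
    held fixed. *)
Lemma is_derive_penalized (R : realType) (f : R -> R) (K T c s df : R) :
  is_derive s 1 f df ->
  is_derive s 1 (fun r => (f r - K) * (T - r) * c)
    (df * (T - s) * c - (f s - K) * c).
Proof.
move=> dfs.
have -> : (fun r => (f r - K) * (T - r) * c) =
  (f - cst K) * (cst T - id) * cst c by [].
apply: is_derive_eq; rewrite !fctE /GRing.scale/=; ring.
Qed.

(* A value above K would make (G - K)(T - t)(1 - x) reach a positive maximum in the
   interior, where both partial derivatives of G are then positive. *)
Lemma transport_max_principle (R : realType) (G lam : R * R -> R) (T K : R) :
  0 < T -> continuous G -> (forall p, 0 <= lam p) ->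
  (forall t x, 0 < t < T -> 0 < x < 1 -> exists gt gx,
    [/\ is_derive t 1 (fun s => G (s, x)) gt,
        is_derive x 1 (fun y => G (t, y)) gx & gt + lam (t, x) * gx <= 0]) ->
  (forall x, 0 <= x <= 1 -> G (0, x) <= K) ->
  (forall t, 0 <= t <= T -> G (t, 0) <= K) ->
  forall t x, 0 <= t <= T -> 0 <= x <= 1 -> G (t, x) <= K.
Proof.
move=> T0 cG lam0 dG G0 Gx0.
have core t x : 0 <= t -> t < T -> 0 <= x -> x < 1 -> G (t, x) <= K.
  move=> t0 tT x0 x1; rewrite leNgt; apply/negP => KG.
  pose F (p : R * R) := (G p - K) * (T - p.1) * (1 - p.2).
  have cF : continuous F.
    move=> p; apply: cvgM; first apply: cvgM.
    - by apply: cvgB; [exact: cG|exact: cvg_cst].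
    - by apply: cvgB; [exact: cvg_cst|exact: cvg_fst].
    - by apply: cvgB; [exact: cvg_cst|exact: cvg_snd].
  pose S := (`[0, T] `*` `[0, 1]) : set (R * R).
  have cS : compact S by apply: compact_setX; exact: segment_compact.
  have Stx : S (t, x) by split; rewrite /= in_itv/= ?t0 ?x0 ltW.
  have S0 : S !=set0 by exists (t, x).
  have [[s y]] := compact_EVT_max S0 cS (continuous_subspaceT cF).
  rewrite inE => -[/=]; rewrite !in_itv/= => /andP[s0 sT] /andP[y0 y1] mF.
  (* A positive maximum lies on no side of the rectangle: F = 0 at t = T and at x = 1, while G <= K
     at t = 0 and at x = 0. *)
  have Fp : 0 < F (s, y).
    apply: lt_le_trans (mF (t, x) (mem_set Stx)).
    by rewrite /F/= !mulr_gt0 ?subr_gt0.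
  have sT' : s < T.
    rewrite lt_neqAle sT andbT; apply/eqP => sE.
    by move: Fp; rewrite /F/= sE subrr mulr0 mul0r ltxx.
  have y1' : y < 1.
    rewrite lt_neqAle y1 andbT; apply/eqP => yE.
    by move: Fp; rewrite /F/= yE subrr mulr0 ltxx.
  have Gp : 0 < G (s, y) - K.
    by move: Fp; rewrite /F/= pmulr_lgt0 ?subr_gt0// pmulr_lgt0 ?subr_gt0.
  have s0' : 0 < s.
    rewrite lt_neqAle s0 andbT; apply/eqP => sE.
    by move: Gp; rewrite -sE subr_gt0 ltNge G0// y0.
  have y0' : 0 < y.
    rewrite lt_neqAle y0 andbT; apply/eqP => yE.
    by move: Gp; rewrite -yE subr_gt0 ltNge Gx0// s0.
  have sI : 0 < s < T by rewrite s0'.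
  have yI : 0 < y < 1 by rewrite y0'.
  have [gt [gx [dt dx gle]]] := dG s y sI yI.
  have d1 : is_derive s 1 (fun r => F (r, y)) (gt * (T - s) * (1 - y) - (G (s, y) - K) * (1 - y)).
    exact: (is_derive_penalized K T (1 - y) dt).
  have d2 : is_derive y 1 (fun r => F (s, r)) (gx * (T - s) * (1 - y) - (G (s, y) - K) * (T - s)).
    rewrite [X in is_derive _ _ X _](_ : _ = (fun r => (G (s, r) - K) * (1 - r) * (T - s))).
      by rewrite mulrAC; exact: (is_derive_penalized K 1 (T - s) dx).
    by apply/funext => r; rewrite /F/= mulrAC.
  have e1 : gt * (T - s) * (1 - y) - (G (s, y) - K) * (1 - y) = 0.
    have h : is_derive s 1 (fun r => F (r, y)) 0.
      apply: (@derive1_at_max _ _ 0 T) => //; first exact: ltW.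
      - move=> r; rewrite in_itv/= => /andP[r0 rT].
        have rI : 0 < r < T by rewrite r0.
        have [? [? [dr _ _]]] := dG r y rI yI.
        by have [] := is_derive_penalized K T (1 - y) dr.
      - move=> r; rewrite in_itv/= => /andP[r0 rT]; apply: mF; rewrite inE.
        by split; rewrite /= in_itv/= ?y0 // (ltW r0) ltW.
    by rewrite -(@derive_val _ _ _ _ _ _ _ d1) (@derive_val _ _ _ _ _ _ _ h).
  have e2 : gx * (T - s) * (1 - y) - (G (s, y) - K) * (T - s) = 0.
    have h : is_derive y 1 (fun r => F (s, r)) 0.
      apply: (@derive1_at_max _ _ 0 1) => //.
      - move=> r; rewrite in_itv/= => /andP[r0 rT].
        have rI : 0 < r < 1 by rewrite r0.
        have [? [? [_ dr _]]] := dG s r sI rI.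
        rewrite [X in derivable X](_ : _ = (fun r => (G (s, r) - K) * (1 - r) * (T - s))).
          by have [] := is_derive_penalized K 1 (T - s) dr.
        by apply/funext => ?; rewrite /F/= mulrAC.
      - move=> r; rewrite in_itv/= => /andP[r0 rT]; apply: mF; rewrite inE.
        by split; rewrite /= in_itv/= ?s0 // (ltW r0) ltW.
    by rewrite -(@derive_val _ _ _ _ _ _ _ d2) (@derive_val _ _ _ _ _ _ _ h).
  (* The vanishing derivatives of F give gt = (G - K) / (T - s) and gx = (G - K) / (1 - y). *)
  have gt0 : 0 < gt.
    have : 0 < gt * ((T - s) * (1 - y)).
      by move/subr0_eq : e1; rewrite mulrA => ->; rewrite mulr_gt0// subr_gt0.
    by rewrite pmulr_lgt0// mulr_gt0// subr_gt0.
  have gx0 : 0 < gx.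
    have : 0 < gx * ((T - s) * (1 - y)).
      by move/subr0_eq : e2; rewrite mulrA => ->; rewrite mulr_gt0// subr_gt0.
    by rewrite pmulr_lgt0// mulr_gt0// subr_gt0.
  by move: gle; rewrite leNgt ltr_wpDr// mulr_ge0// ltW.
(* On the edges x = 1 and t = T the penalty vanishes and carries no information; they are reached as
   left limits. *)
have left_lim (f : R -> R) a b : a < b -> continuous f ->
    (forall x, a <= x -> x < b -> f x <= K) -> f b <= K.
  move=> ab cf fK.
  rewrite leNgt; apply/negP => Kf.
  have h : \forall x \near b^'-, K < f x.
    exact: (cvgr_gt (f b) (cvg_at_left_filter (cf b))).
  near b^'- => x.
  have : K < f x by near: x.
  rewrite ltNge fK//; near: x; exact: nbhs_left_ge.
have core2 t x : 0 <= t -> t < T -> 0 <= x -> x <= 1 -> G (t, x) <= K.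
  move=> t0 tT x0; rewrite le_eqVlt => /predU1P[->|]; last exact: core.
  apply: (left_lim (fun y => G (t, y)) 0) => //.
    exact: continuous_curry_snd.
  by move=> *; exact: core.
move=> t x /andP[t0 tT] /andP[x0 x1]; move: tT.
rewrite le_eqVlt => /predU1P[->|tT]; last exact: core2.
apply: (left_lim (fun s => G (s, x)) 0) => //.
  exact: continuous_curry_fst.
by move=> *; exact: core2.
Unshelve. all: by end_near. Qed.

Lemma is_derive_comp_diff (R : numFieldType) (V W : normedModType R)
    (c : R -> V) (f : V -> W) (s : R) (dc : V) :
  is_derive s (1 : R) c dc -> differentiable f (c s) ->
  is_derive s (1 : R) (fun r => f (c r)) ('d f (c s) dc).
Proof.
move=> [dcs <-] df; have dcs' : differentiable c s by apply/derivable1_diffP.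
apply: DeriveDef.
  by apply/derivable1_diffP; exact: differentiable_comp.
rewrite deriveE; last exact: differentiable_comp.
by rewrite diff_comp//= deriveE.
Qed.

Lemma is_derive_pair (R : numFieldType) (V W : normedModType R)
    (f : R -> V) (g : R -> W) (s : R) df dg :
  is_derive s (1 : R) f df -> is_derive s (1 : R) g dg ->
  is_derive s (1 : R) (fun r => (f r, g r)) (df, dg).
Proof.
move=> [dfs <-] [dgs <-].
have dfs' : differentiable f s by apply/derivable1_diffP.
have dgs' : differentiable g s by apply/derivable1_diffP.
apply: DeriveDef.
  by apply/derivable1_diffP; exact: differentiable_pair.
rewrite deriveE; last exact: differentiable_pair.
by rewrite diff_pair//= !deriveE.
Qed.

Lemma is_derive_fst (R : numFieldType) (W : normedModType R)
    (f : R * R -> W) (t x : R) :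
  differentiable f (t, x) ->
  is_derive t (1 : R) (fun s => f (s, x)) ('d f (t, x) (1, 0)).
Proof.
by move=> df; apply: (@is_derive_comp_diff _ _ _ (fun s => (s, x)) f) => //; exact: is_derive_pair.
Qed.

Lemma is_derive_snd (R : numFieldType) (W : normedModType R)
    (f : R * R -> W) (t x : R) :
  differentiable f (t, x) ->
  is_derive x (1 : R) (fun y => f (t, y)) ('d f (t, x) (0, 1)).
Proof.
by move=> df; apply: (@is_derive_comp_diff _ _ _ (fun y => (t, y)) f) => //; exact: is_derive_pair.
Qed.

Lemma is_derive_expR_mul (R : realType) (f : R -> R) (a b s df : R) :
  is_derive s 1 f df ->
  is_derive s 1 (fun r => expR (a * r + b) * f r)
    (a * (expR (a * s + b) * f s) + expR (a * s + b) * df).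
Proof.
move=> dfs.
have de : is_derive s 1 (fun r => expR (a * r + b)) (a * expR (a * s + b)).
  have dl : is_derive s 1 (fun r => a * r + b) a.
    have -> : (fun r => a * r + b) = a *: id + cst b by [].
    by apply: is_derive_eq; rewrite addr0 /GRing.scale/= mulr1.
  have := @is_derive1_comp _ expR (fun r => a * r + b) s _ _ (is_derive_expR _) dl.
  by rewrite mulrC.
have := @is_deriveM _ _ (fun r => expR (a * r + b)) f s 1 _ _ de dfs.
rewrite /GRing.scale/= (_ : f s * _ = a * (expR (a * s + b) * f s)); last by ring.
by rewrite addrC.
Qed.

Lemma pair_direction (R : numFieldType) (a : R) :
  ((1, a) : R * R) = (1, 0) + a *: (0, 1).
Proof.
by rewrite -[RHS]/(1 + a * 0, 0 + a * 1) mulr0 mulr1 addr0 add0r.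
Qed.

Definition clamp01 (R : realType) (x : R) : R := Num.min 1 (Num.max 0 x).

(* Retraction of the plane onto [0, +oo[ * [0, 1]: composing with it makes a solution
   continuous on the whole plane, whatever its values outside the strip. *)
Definition strip_clamp (R : realType) (p : R * R) : R * R :=
  (Num.max 0 p.1, clamp01 p.2).

Lemma clamp01_id (R : realType) (x : R) : 0 <= x <= 1 -> clamp01 x = x.
Proof. by move=> /andP[x0 x1]; rewrite /clamp01 max_r// min_r. Qed.

Lemma clamp01_itv (R : realType) (x : R) : 0 <= clamp01 x <= 1.
Proof. by rewrite /clamp01 le_min ler01 le_max lexx/= ge_min lexx. Qed.

Lemma continuous_maxl0 (R : realType) : continuous (fun x : R => Num.max 0 x).
Proof.
move=> x; change {for x, continuous ((cst 0 : R -> R^o) \max idfun)}.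
by apply: continuous_max; [exact: cvg_cst|exact: cvg_id].
Qed.

Lemma continuous_clamp01 (R : realType) : continuous (@clamp01 R).
Proof.
move=> x; change {for x, continuous ((cst 1 : R -> R^o) \min (fun x => Num.max 0 x))}.
by apply: continuous_min; [exact: cvg_cst|exact: continuous_maxl0].
Qed.

Lemma continuous_strip_clamp (R : realType) : continuous (@strip_clamp R).
Proof.
move=> p.
apply: (cvg_pair (F := nbhs p) (G := nbhs (Num.max 0 p.1))
  (H := nbhs (clamp01 p.2)) (f := fun q => Num.max 0 q.1) (g := fun q => clamp01 q.2)).
  apply: (@continuous_comp _ _ _ fst (fun x : R => Num.max 0 x)); first exact: cvg_fst.
  exact: continuous_maxl0.
apply: (@continuous_comp _ _ _ snd (@clamp01 R)); first exact: cvg_snd.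
exact: continuous_clamp01.
Qed.

Lemma strip_clampE (R : realType) (t x : R) :
  0 <= t -> 0 <= x <= 1 -> strip_clamp (t, x) = (t, x).
Proof. by move=> t0 x01; rewrite /strip_clamp/= max_r// clamp01_id. Qed.

(** [strip_clamp] takes its values in the strip, so continuity relative to the strip suffices. *)
Lemma continuous_strip_extension (R : realType) (T : topologicalType)
    (u : R * R -> T) :
  {within [set p : R * R | 0 <= p.1 /\ 0 <= p.2 <= 1], continuous u} ->
  continuous (u \o @strip_clamp R).
Proof.
move=> /subspace_continuousP cu p.
set S := [set p : R * R | 0 <= p.1 /\ 0 <= p.2 <= 1] in cu.
have Sc q : S (strip_clamp q) by split; rewrite /= ?le_max ?lexx ?clamp01_itv.
have h : (strip_clamp q @[q --> p]) --> within S (nbhs (strip_clamp p)).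
  move=> U /= hU;
  have h' : nbhs p (strip_clamp (R := R) @^-1` (fun x => S x -> U x)).
    exact: continuous_strip_clamp hU.
  by apply: (filterS (F := nbhs p) _ h') => q /= ; exact.
exact: (cvg_comp _ _ h (cu _ (Sc p))).
Qed.

Section ClassicalSolution.
Variables (R : realType) (d : nat) (A : 'M[R]_d) (lam : R * R -> R).
Variables (u0 : R -> 'cV[R]_d) (u : R * R -> 'cV[R]_d).
Hypothesis sol : classical_solution A lam u0 u.

Lemma solution_differentiable (t x : R) : 0 < t -> 0 < x < 1 -> differentiable u (t, x).
Proof. by have [_ [du _] _ _ _] := sol => t0 x01; apply: du. Qed.

Lemma solution_transport (t x : R) : 0 < t -> 0 < x < 1 -> 'd u (t, x) (1, lam (t, x)) = 0.
Proof.
have [_ _ pde _ _] := sol => t0 x01; have := pde t x t0 x01.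
have du := solution_differentiable t0 x01.
have [_ e1] := is_derive_fst du; have [_ e2] := is_derive_snd du.
rewrite !derive1E e1 e2.
by rewrite -linearZ -linearD -pair_direction.
Qed.

Lemma solution_continuous : continuous (u \o @strip_clamp R).
Proof. by apply: continuous_strip_extension; case: sol. Qed.

(* The weight e^(ga t - mu x) with ga = mu lmin makes the quadratic form a subsolution,
   and e^mu = 1/q leaves the factor q < 1 in the boundary condition. *)
Lemma solution_bound (I : finType) (r : I -> 'rV[R]_d) (q lmin K : R) :
  0 < q < 1 -> 0 < lmin -> (forall p, lmin <= lam p) ->
  (forall v, sumsq r (A *m v) <= q ^+ 2 * sumsq r v) ->
  (forall x, 0 <= x <= 1 -> sumsq r (u0 x) <= K) ->
  forall t x : R, 0 <= t -> 0 <= x <= 1 ->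
    sumsq r (u (t, x)) <= q^-1 * expR (ln q * lmin * t) * K.
Proof.
move=> /andP[q0 q1] l0 lamge rA hK t x t0 x01.
have [_ _ _ bc ic] := sol.
pose mu := - ln q; pose ga := mu * lmin.
have mu0 : 0 < mu by rewrite oppr_gt0 ln_lt0// q0.
have emu : expR mu = q^-1 by rewrite /mu expRN lnK// posrE.
(* [z] is the weighted form and [G] its continuous extension to the plane; they agree near interior
   points, so derivatives of [z] carry over to [G]. *)
pose z (p : R * R) := expR (ga * p.1 - mu * p.2) * sumsq r (u p).
pose G (p : R * R) := expR (ga * p.1 - mu * p.2) * sumsq r (u (strip_clamp p)).
have Gz (s y : R) : 0 <= s -> 0 <= y <= 1 -> G (s, y) = z (s, y).
  by move=> s0 y01; rewrite /G /z strip_clampE.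
have cG : continuous G.
  move=> p; apply: cvgM; last first.
    apply: (@continuous_comp _ _ _ (u \o @strip_clamp R) (sumsq r)).
      exact: solution_continuous.
    exact: continuous_sumsq.
  apply: continuous_comp; last exact: continuous_expR.
  apply: cvgB; (apply: cvgM; first exact: cvg_cst); [exact: cvg_fst|exact: cvg_snd].
(* The extra unit keeps T positive when t = 0. *)
pose T := t + 1; have T0 : 0 < T by rewrite ltr_wpDl.
pose S := (`[0, T] `*` `[0, 1]) : set (R * R).
have cS : compact S by apply: compact_setX; exact: segment_compact.
have SP (s y : R) : 0 <= s <= T -> 0 <= y <= 1 -> (s, y) \in S.
  by move=> sT y1; rewrite inE; split; rewrite /= in_itv.
have S0 : S !=set0 by exists (0, 0); apply: set_mem; apply: SP; rewrite !lexx ?ler01 ?ltW.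
have [c Sc mG] := compact_EVT_max S0 cS (continuous_subspaceT cG).
have G0 p : 0 <= G p by rewrite mulr_ge0 ?expR_ge0 ?sumsq_ge0.
have K0 : 0 <= K by apply: le_trans (hK 0 _); rewrite ?sumsq_ge0 ?lexx ?ler01.
(* On x = 0 the value is at most q times the maximum [G c]. Hence [G c] is at most the larger of K
   and q times itself, and q < 1 together with K >= 0 leaves [G c <= K]. *)
have max_le : forall s y : R, 0 <= s <= T -> 0 <= y <= 1 -> G (s, y) <= Num.max K (q * G c).
  apply: (transport_max_principle (lam := lam)) => //.
  - by move=> p; apply: le_trans (lamge p); exact: ltW.
  - move=> s y /andP[s0 sT] y01; have /andP[y0 y1] := y01.
    have y01' : 0 <= y <= 1 by rewrite !ltW.
    have du := solution_differentiable s0 y01.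
    have dQ : differentiable (sumsq r \o u) (s, y).
      by apply: differentiable_comp => //; exact: differentiable_sumsq.
    have tQ : 'd (sumsq r \o u) (s, y) (1, lam (s, y)) = 0.
      rewrite diff_comp//=; last exact: differentiable_sumsq.
      by rewrite solution_transport// linear0.
    have d1 := is_derive_fst dQ; have d2 := is_derive_snd dQ.
    set a := 'd _ _ _ in d1; set b := 'd _ _ _ in d2.
    have ab : a + lam (s, y) * b = 0.
      by rewrite -tQ /a /b -[_ * _]/(_ *: _) -linearZ -linearD -pair_direction.
    pose e := expR (ga * s - mu * y).
    exists (ga * G (s, y) + e * a), (- mu * G (s, y) + e * b); split.
    + apply: (near_eq_is_derive (f := fun s : R => z (s, y))).
        by near=> s'; rewrite Gz//; apply: ltW; near: s'; exact: lt_nbhsr.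
      rewrite Gz; [|exact: ltW|exact: y01'].
      exact: (is_derive_expR_mul ga (- (mu * y)) d1).
    + apply: (near_eq_is_derive (f := fun y : R => z (s, y))).
        near=> y'; rewrite Gz; [by []|exact: ltW|].
        apply/andP; split; apply: ltW; near: y'; first exact: lt_nbhsr.
        exact: lt_nbhsl.
      rewrite Gz; [|exact: ltW|exact: y01'].
      have e1 (y' : R) : ga * s - mu * y' = - mu * y' + ga * s by ring.
      rewrite /z /e /=; under eq_fun do rewrite e1.
      rewrite e1; exact: (is_derive_expR_mul (- mu) (ga * s) d2).
    + rewrite mulrDr addrACA [lam _ * (e * _)]mulrCA -mulrDr ab mulr0 addr0.
      have -> : ga * G (s, y) + lam (s, y) * (- mu * G (s, y)) =
        (ga - mu * lam (s, y)) * G (s, y) by ring.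
      by rewrite mulr_le0_ge0// subr_le0 /ga ler_wpM2l ?(ltW mu0).
  - move=> y y01; rewrite Gz// /z ic//= mulr0 add0r le_max; apply/orP; left.
    apply: le_trans (hK y y01); rewrite ler_piMl ?sumsq_ge0// -expR0 ler_expR.
    by rewrite oppr_le0 mulr_ge0 ?(ltW mu0)//; case/andP: y01.
  - move=> s sT; have /andP[s0 _] := sT; rewrite le_max; apply/orP; right.
    apply: (@le_trans _ _ (q * G (s, 1))); last first.
      rewrite ler_wpM2l ?(ltW q0)//; apply: mG; apply: SP; rewrite ?lexx ?ler01//.
    rewrite !Gz ?lexx ?ler01// /z bc//= mulr0 subr0 mulr1 expRD expRN emu invrK.
    apply: le_trans (ler_wpM2l (expR_ge0 _) (rA _)) _.
    by rewrite le_eqVlt; apply/orP; left; apply/eqP; ring.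
have GcK : G c <= K.
  have : G c <= Num.max K (q * G c).
    move: Sc; rewrite inE => -[]; rewrite /= !in_itv/= => c1 c2.
    by rewrite {1}(surjective_pairing c); exact: max_le.
  rewrite le_max => /orP[//|h].
  have : G c <= 0.
    have : (1 - q) * G c <= 0 by rewrite mulrBl mul1r subr_le0.
    by rewrite pmulr_rle0// subr_gt0.
  by move=> h0; exact: le_trans K0.
have : G (t, x) <= K.
  by apply: le_trans GcK; apply: mG; apply: SP => //; rewrite t0 lerDl ler01.
rewrite Gz// /z/= => h.
have e0 : 0 < expR (ga * t - mu * x) by exact: expR_gt0.
move: h; rewrite -ler_pdivlMl// => /le_trans; apply.
(* Removing the weight costs [expR (mu * x)], at most [expR mu], which is the factor [q^-1] of the
   bound. *)
rewrite -expRN opprB expRD ler_wpM2r// -emu (_ : - (ga * t) = ln q * lmin * t); last first.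
  by rewrite /ga /mu; ring.
rewrite ler_wpM2r ?expR_ge0// ler_expR ger_pMr//.
by case/andP: x01.
Unshelve. all: by end_near. Qed.
End ClassicalSolution.

(** The norm with infinite exponent is defined by a case distinction on the positivity of the total
    measure. *)
Lemma lebesgue_measure_setT_gt0 (R : realType) :
  (0 < @lebesgue_measure R [set: R])%E.
Proof.
apply: (@lt_le_trans _ _ (@lebesgue_measure R `[0, 1])).
  by rewrite lebesgue_measure_itv/= lte_fin ltr01 sube0 lte_fin.
by apply: le_measure; rewrite ?inE.
Qed.

(** A value above K would persist on a nondegenerate interval, which is not negligible. This turns
    essential bounds into pointwise ones. *)
Lemma continuous_ae_le (R : realType) (f : R -> R) (K : R) :
  continuous f -> {ae @lebesgue_measure R, forall x, 0 <= x <= 1 -> f x <= K} ->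
  forall x, 0 <= x <= 1 -> f x <= K.
Proof.
move=> cf [B [mB B0 hB]] x /andP[x0 x1]; rewrite leNgt; apply/negP => Kf.
have /nbhs_ballP[e /= e0 he] : \forall y \near x, K < f y by exact: (cvgr_gt (f x) (cf x)).
(* Cutting the ball to [0, 1] keeps a positive length even if x is an end point. *)
pose a := Num.max 0 (x - e); pose b := Num.min 1 (x + e).
have ab : a < b.
  by rewrite /a /b lt_min !gt_max; apply/andP; split; apply/andP; split; lra.
have IB : `]a, b[ `<=` B.
  move=> y /=; rewrite in_itv/= /a /b gt_max lt_min => /and3P[/andP[y0 yx] y1 yx'].
  apply: hB => /= h; have : f y <= K by apply: h; rewrite !ltW.
  rewrite leNgt => /negP; apply; apply: he.
  by rewrite /ball/= ltr_norml; apply/andP; split; lra.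
have : (@lebesgue_measure R `]a, b[%classic <= @lebesgue_measure R B)%E.
  by apply: le_measure; rewrite ?inE//; exact: measurable_itv.
rewrite B0 lebesgue_measure_itv/= lte_fin ab leNgt => /negP; apply.
by rewrite -EFinB lte_fin subr_gt0.
Qed.

Section LinftyNorm.
Variables (R : realType) (d : nat) (N : 'cV[R]_d -> R).
Hypothesis NN : is_norm N.
Implicit Type v : R -> 'cV[R]_d.

Lemma Lnorm01_infty_le v (M : R) : 0 <= M -> (forall x, 0 <= x <= 1 -> N (v x) <= M) ->
  (Lp_norm01 N +oo v <= M%:E)%E.
Proof.
move=> M0 vM; rewrite /Lp_norm01 unlock lebesgue_measure_setT_gt0.
apply/ess_supP; apply: aeW => x /=; rewrite lee_fin /patch.
case: ifPn => [|_]; last by rewrite normr0.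
rewrite inE/= in_itv/= => x01.
by rewrite ger0_norm ?vM// is_norm_ge0.
Qed.

(** The values of [v] outside [0, 1] are arbitrary, so continuity is carried by an extension [f] of
    N o v. *)
Lemma Lnorm01_infty_ge v (f : R -> R) : continuous f ->
  (forall x, 0 <= x <= 1 -> f x = N (v x)) ->
  forall x, 0 <= x <= 1 -> ((N (v x))%:E <= Lp_norm01 N +oo v)%E.
Proof.
move=> cf fv x x01.
have H K : (Lp_norm01 N +oo v <= K%:E)%E -> N (v x) <= K.
  rewrite /Lp_norm01 unlock lebesgue_measure_setT_gt0 => /ess_supP h.
  rewrite -fv//; apply: (continuous_ae_le cf) => //.
  apply: filterS h => y /=; rewrite lee_fin /patch => h y01; rewrite fv//.
  by move: h; rewrite mem_set /= ?in_itv//=; apply: le_trans; exact: ler_norm.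
case: (Lp_norm01 N +oo v) H => [K||] H.
- by rewrite lee_fin H.
- by rewrite leey.
- by have := H (N (v x) - 1) (leNye _); rewrite leNgt ltrBlDr ltrDl ltr01.
Qed.

End LinftyNorm.

Section LinftyDecay.
Variables (R : realType) (d : nat) (N : 'cV[R]_d -> R).
Variables (A : 'M[R]_d) (lam : R * R -> R) (lmin : R).
Hypotheses (d_gt0 : (0 < d)%N) (N_norm : is_norm N) (A_lt1 : spectral_radius A < 1).
Hypotheses (lmin_gt0 : 0 < lmin) (lam_ge : forall p, lmin <= lam p).

Lemma sumsq_norm_equiv (I : finType) (r : I -> 'rV[R]_d) :
  (forall v, sumsq r v = 0 -> v = 0) ->
  exists c C, [/\ 0 < c, 0 < C &
    forall v, c * N v <= Num.sqrt (sumsq r v) <= C * N v].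
Proof.
move=> r0; apply: homogeneous_equiv => //.
- move=> v; apply: continuous_comp; first exact: continuous_sumsq.
  exact: sqrt_continuous.
- by move=> a v; rewrite sumsqZ sqrtrM ?sqr_ge0// sqrtr_sqr.
- by move=> v /eqP; rewrite sqrtr_eq0 => h; apply: r0; apply/eqP; rewrite eq_le h sumsq_ge0.
Qed.

Lemma Linfty_decay : exists C gamma : R, [/\ 0 < C, 0 < gamma &
     forall (u0 : R -> 'cV[R]_d) (u : R * R -> 'cV[R]_d),
       classical_solution A lam u0 u ->
       forall t : R, 0 <= t ->
         (Lp_norm01 N +oo (fun x => u (t, x))
            <= (C * expR (- gamma * t))%:E * Lp_norm01 N +oo u0)%E].
Proof.
have rho0 := spectral_radius_ge0 A d_gt0.
pose q := (spectral_radius A + 1) / 2.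
have q0 : 0 < q by rewrite divr_gt0// ltr_wpDl.
have q1 : q < 1 by rewrite ltr_pdivrMr// mul1r ltrD2r.
have q01 : 0 < q < 1 by rewrite q0.
have rq : spectral_radius A < q by rewrite ltr_pdivlMr// mulr2n mulrDr mulr1 ltrD2l.
have [I [r [r0 rA]]] := adapted_form d_gt0 rq.
have [c [C [c0 C0 cC]]] := sumsq_norm_equiv r0.
(* The bound for the quadratic form has factor [q^-1] and rate [- ln q * lmin]; passing to its
   square root gives [k] and half that rate. *)
pose k := Num.sqrt q^-1.
have k0 : 0 < k by rewrite sqrtr_gt0 invr_gt0.
exists (c^-1 * k * C), (- ln q * lmin / 2); split.
- by rewrite !mulr_gt0// invr_gt0.
- by rewrite divr_gt0// mulr_gt0// oppr_gt0 ln_lt0.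
move=> u0 u sol t t0.
have [_ _ _ _ ic] := sol.
pose f x := N (u (strip_clamp (0, x))).
have cf : continuous f.
  move=> x; apply: (@continuous_comp _ _ _ (fun y => u (strip_clamp (0, y))) N).
    exact: (continuous_curry_snd (G := u \o @strip_clamp R) (t := 0) (solution_continuous sol)).
  exact: is_norm_continuous.
have fu x : 0 <= x <= 1 -> f x = N (u0 x).
  by move=> x01; rewrite /f strip_clampE// ic.
have H := Lnorm01_infty_ge cf fu.
set M := c^-1 * k * C * expR _.
have M0 : 0 < M by rewrite !mulr_gt0 ?invr_gt0 ?expR_gt0.
case: (Lp_norm01 N +oo u0) H => [E| |] H.
- have hE x : 0 <= x <= 1 -> N (u0 x) <= E by move=> x01; rewrite -lee_fin H.
  have E0 : 0 <= E by apply: le_trans (hE 0 _); rewrite ?is_norm_ge0 ?lexx ?ler01.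
  rewrite -EFinM; apply: Lnorm01_infty_le => //; first by rewrite mulr_ge0 ?(ltW M0).
  move=> x x01.
  have hK y : 0 <= y <= 1 -> sumsq r (u0 y) <= (C * E) ^+ 2.
    move=> y01; rewrite -[leLHS](sqr_sqrtr (sumsq_ge0 _ _)) ler_sqr ?nnegrE ?sqrtr_ge0//.
      have /andP[_ h] := cC (u0 y); apply: (le_trans h).
      by rewrite ler_wpM2l ?(ltW C0)// hE.
    by rewrite mulr_ge0 ?(ltW C0).
  have h := solution_bound sol q01 lmin_gt0 lam_ge rA hK t0 x01.
  have /andP[h1 _] := cC (u (t, x)).
  move: h1; rewrite mulrC -ler_pdivlMr// => /le_trans; apply.
  rewrite ler_pdivrMr//.
  have -> : M * E * c = k * expR (ln q * lmin * t / 2) * (C * E).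
    rewrite /M (_ : - (- ln q * lmin / 2) * t = ln q * lmin * t / 2); last by field.
    by field; rewrite gt_eqF.
  rewrite -(@ger0_norm _ (k * _ * _)); last first.
    by rewrite !mulr_ge0 ?(ltW k0) ?(ltW C0) ?expR_ge0.
  rewrite -sqrtr_sqr ler_wsqrtr//; apply: (le_trans h).
  rewrite !exprMn sqr_sqrtr ?invr_ge0 ?(ltW q0)// -expRM_natl.
  rewrite (_ : 2 * _ = ln q * lmin * t); last by field.
  by [].
- by rewrite gt0_muley ?lte_fin// leey.
- by have := H 0; rewrite lexx ler01 => /(_ isT).
Qed.
End LinftyDecay.

(** * Characteristics *)

Lemma le_of_derive_le0 (R : realType) (f df : R -> R) (a b : R) : a <= b ->
  (forall x : R, a < x < b -> is_derive x 1 f (df x)) ->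
  (forall x, a < x < b -> df x <= 0) ->
  {within `[a, b], continuous f} -> f b <= f a.
Proof.
rewrite le_eqVlt => /predU1P[->//|ab] fd df0 cf.
have fd' (x : R) : x \in `]a, b[%R -> is_derive x 1 f (df x) by rewrite in_itv/=; exact: fd.
have [c cab e] := MVT ab fd' cf.
rewrite -subr_le0 e mulr_le0_ge0 ?subr_ge0 ?(ltW ab)//.
by rewrite in_itv/= in cab; exact: df0.
Qed.

Lemma le_of_derive_ge0 (R : realType) (f df : R -> R) (a b : R) : a <= b ->
  (forall x : R, a < x < b -> is_derive x 1 f (df x)) ->
  (forall x, a < x < b -> 0 <= df x) ->
  {within `[a, b], continuous f} -> f a <= f b.
Proof.
move=> ab fd df0 cf; rewrite -lerN2.
apply: (@le_of_derive_le0 _ (fun x => - f x) (fun x => - df x)) => //.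
- by move=> x xab; apply: is_deriveN; exact: fd.
- by move=> x xab; rewrite oppr_le0 df0.
- by move=> x; apply: cvgN; exact: cf.
Qed.

Lemma is_derive_continuous (R : realType) (f df : R -> R) :
  (forall x : R, is_derive x (1 : R) f (df x)) -> continuous f.
Proof.
move=> fd x; have [dx _] := fd x.
by apply: differentiable_continuous; apply/derivable1_diffP.
Qed.

(** D^2 times e^(- 2 L x) is nonincreasing and D^2 times e^(2 L x) is nondecreasing; squares avoid
    differentiating an absolute value. *)
Lemma gronwall_abs (R : realType) (D dD : R -> R) (L : R) :
  (forall r : R, is_derive r 1 D (dD r)) -> (forall r, `|dD r| <= L * `|D r|) ->
  forall s r, s <= r ->
    `|D r| <= `|D s| * expR (L * (r - s)) /\ `|D s| <= `|D r| * expR (L * (r - s)).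
Proof.
move=> Dd DL s r sr.
have bd x : - (L * D x ^+ 2) <= D x * dD x <= L * D x ^+ 2.
  rewrite -ler_norml normrM -(real_normK (num_real (D x))) expr2 mulrA.
  by rewrite mulrC ler_wpM2r.
have D2 (x : R) : is_derive x 1 (fun y => D y ^+ 2) (2 * (D x * dD x)).
  have -> : (fun y => D y ^+ 2) = D * D by apply/funext => y; rewrite expr2.
  by apply: is_derive_eq; rewrite /GRing.scale/=; ring.
(* The [+ 0] matches the affine exponent in [is_derive_expR_mul]. *)
pose f (a x : R) := expR (a * x + 0) * D x ^+ 2.
have fd (a x : R) : is_derive x 1 (f a) (expR (a * x + 0) * (a * D x ^+ 2 + 2 * (D x * dD x))).
  have := is_derive_expR_mul a 0 (D2 x).
  by rewrite mulrCA -mulrDr.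
have cf a : continuous (f a) by apply: is_derive_continuous; exact: fd.
have key (x y a : R) : 0 <= x -> 0 <= y -> x ^+ 2 <= expR (2 * a) * y ^+ 2 -> x <= y * expR a.
  move=> x0 y0 h; rewrite -(@ler_pXn2r _ 2) ?nnegrE// ?mulr_ge0 ?expR_ge0//.
  by rewrite exprMn -expRM_natl mulrC.
split; apply: key => //; rewrite !real_normK ?num_real//.
- have : f (- (2 * L)) r <= f (- (2 * L)) s.
    apply: (le_of_derive_le0 sr (fun x _ => fd _ x)).
      move=> x _; rewrite mulr_ge0_le0 ?expR_ge0//; have := bd x; lra.
    exact: continuous_subspaceT.
  rewrite /f !addr0 -ler_pdivlMl ?expR_gt0// -expRN => /le_trans; apply.
  by rewrite [leLHS]mulrA -expRD (_ : _ + _ = 2 * (L * (r - s))); last by ring.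
- have : f (2 * L) s <= f (2 * L) r.
    apply: (le_of_derive_ge0 sr (fun x _ => fd _ x)).
      move=> x _; rewrite mulr_ge0 ?expR_ge0//; have := bd x; lra.
    exact: continuous_subspaceT.
  rewrite /f !addr0 -ler_pdivlMl ?expR_gt0// -expRN => /le_trans; apply.
  by rewrite [leLHS]mulrA -expRD (_ : _ + _ = 2 * (L * (r - s))); last by ring.
Qed.

Lemma lipschitz_of_derive (R : realType) (f : R -> R) (L : R) :
  (forall x : R, derivable f x 1) -> (forall x, - L <= derive1 f x <= L) ->
  forall x y, `|f x - f y| <= L * `|x - y|.
Proof.
move=> fd fL.
have H x y : x < y -> `|f x - f y| <= L * `|x - y|.
  move=> xy; rewrite distrC (distrC x).
  have fd' (z : R) : is_derive z 1 f (derive1 f z) by rewrite derive1E; exact/derivableP.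
  have [c _ ->] := MVT xy (fun z _ => fd' z)
    (continuous_subspaceT (is_derive_continuous fd')).
  by rewrite normrM ler_wpM2r// ler_norml.
move=> x y; have [xy|xy|->] := ltgtP x y.
- exact: H.
- by rewrite distrC (distrC x); exact: H.
- by rewrite !subrr normr0 mulr0.
Qed.

Section ODE.
Variables (R : realType) (lam : R * R -> R) (lmin lmax L : R).
Hypothesis lmin_gt0 : 0 < lmin.
Hypothesis lam_bd : forall p, lmin <= lam p <= lmax.
Hypothesis lam_lip : forall t x y, `|lam (t, x) - lam (t, y)| <= L * `|x - y|.

Definition is_characteristic (a : R -> R) : Prop :=
  forall r : R, is_derive r 1 a (lam (r, a r)).

Lemma characteristic_continuous a : is_characteristic a -> continuous a.
Proof. exact: is_derive_continuous. Qed.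

Lemma characteristic_speed a : is_characteristic a ->
  forall s r, s <= r -> lmin * (r - s) <= a r - a s <= lmax * (r - s).
Proof.
move=> ha s r; rewrite le_eqVlt => /predU1P[->|sr]; first by rewrite !subrr !mulr0 lexx.
have [c _ ->] := MVT sr (fun x _ => ha x)
  (continuous_subspaceT (characteristic_continuous ha)).
have /andP[l1 l2] := lam_bd (c, a c).
by rewrite !ler_wpM2r ?subr_ge0 ?(ltW sr).
Qed.

Lemma characteristic_gap_abs a b : is_characteristic a -> is_characteristic b ->
  forall s r, s <= r ->
    `|a r - b r| <= `|a s - b s| * expR (L * (r - s)) /\
    `|a s - b s| <= `|a r - b r| * expR (L * (r - s)).
Proof.
move=> ha hb; apply: gronwall_abs; first by move=> r; exact: is_deriveB (ha r) (hb r).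
by move=> r; exact: lam_lip.
Qed.

Lemma characteristic_unique a b : is_characteristic a -> is_characteristic b ->
  forall s r, s <= r -> a s = b s -> a r = b r.
Proof.
move=> ha hb s r sr e; have [+ _] := characteristic_gap_abs ha hb sr.
by rewrite e subrr normr0 mul0r normr_le0 subr_eq0 => /eqP.
Qed.

Lemma characteristic_gap a b : is_characteristic a -> is_characteristic b ->
  forall s r, s <= r -> b s < a s ->
    (a s - b s) * expR (- (L * (r - s))) <= a r - b r <= (a s - b s) * expR (L * (r - s)).
Proof.
move=> ha hb s r sr ba.
have [h1 h2] := characteristic_gap_abs ha hb sr.
have abr : b r < a r.
  rewrite ltNge; apply/negP => abr.
  have cD : {within `[s, r], continuous (fun x => a x - b x)}.
    apply: continuous_subspaceT => x.
    by apply: cvgB; [exact: (characteristic_continuous ha)|exact: (characteristic_continuous hb)].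
  have D0 : Num.min (a s - b s) (a r - b r) <= 0 <= Num.max (a s - b s) (a r - b r).
    apply/andP; split; first by rewrite ge_min; apply/orP; right; rewrite subr_le0.
    by rewrite le_max; apply/orP; left; rewrite subr_ge0 ltW.
  have [c /[!in_itv]/= /andP[sc cr] c0] := IVT sr cD D0.
  have [_] := characteristic_gap_abs ha hb sc.
  by rewrite c0 normr0 mul0r normr_le0 subr_eq0 gt_eqF.
rewrite !gtr0_norm ?subr_gt0// in h1 h2.
by rewrite h1 andbT expRN ler_pdivrMr ?expR_gt0.
Qed.

End ODE.

Lemma differentiable_estimate (R : realType) (V W : normedModType R)
    (f : V -> W) (p : V) (e : R) : differentiable f p -> 0 < e ->
  \forall v \near (0 : V), `|f (v + p) - f p - 'd f p v| <= e * `|v|.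
Proof.
move=> /diff_locallyP[_ /eqaddoP h] e0.
have := h e e0; apply: filterS => v /=.
by rewrite fctE /= opprD addrA.
Qed.

Lemma pair_norm_le (R : realType) (x y B : R) :
  `|x| <= B -> `|y| <= B -> `|(x, y)| <= B.
Proof. by move=> xB yB; rewrite /Num.norm/= ge_max xB. Qed.

(** The lower bound [l] and the expansion of F at (h t, t) show that increments of h at t are O(k);
    expanding F (h (t + k), t + k) = 0 at the same point then yields the derivative - b / a. *)
Lemma implicit_derivable (R : realType) (F : R * R -> R) (h : R -> R) (t l : R) :
  differentiable F (h t, t) -> 0 < l ->
  (forall s, F (h s, s) = 0) ->
  (forall r r' s, l * `|r - r'| <= `|F (r, s) - F (r', s)|) ->
  'd F (h t, t) (1, 0) != 0 -> derivable h t 1.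
Proof.
move=> dF l0 F0 Fl a0.
set a := 'd F _ _ in a0; pose b := 'd F (h t, t) (0, 1).
have dFE x y : 'd F (h t, t) (x, y) = x * a + y * b.
  rewrite (_ : (x, y) = x *: (1, 0) + y *: (0, 1)) ?linearD ?linearZ//.
  by rewrite -[RHS]/(x * 1 + y * 0, x * 0 + y * 1) !mulr0 !mulr1 addr0 add0r.
have near_norm (x : R) : 0 < x -> \forall k \near (0 : R), `|k| < x.
  move=> x0; apply/nbhs_ballP; exists x => // k.
  by rewrite /ball/= sub0r normrN.
(* With tolerance 1 in the expansion, |F (h t, t + k)| <= (|b| + 1) |k|; dividing by l bounds the
   increment of h. *)
pose K := (`|b| + 1) / l.
have K0 : 0 < K by rewrite divr_gt0// ltr_wpDl.
have pair_small (P : R * R -> Prop) : (\forall v \near (0 : R * R), P v) ->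
    exists2 e', 0 < e' & forall v, `|v.1| < e' -> `|v.2| < e' -> P v.
  move=> /nbhs_ballP[e' /= e'0 he]; exists e' => // v v1 v2; apply: he.
  by split; rewrite /ball/= sub0r normrN.
have hlip : \forall k \near (0 : R), `|h (k + t) - h t| <= K * `|k|.
  have [e' e'0 he] := pair_small _ (differentiable_estimate dF ltr01).
  near=> k.
  have := he (0, k); rewrite /= normr0 => /(_ e'0).
  have -> : (0, k) + (h t, t) = (h t, k + t) by rewrite -[LHS]/(0 + h t, k + t) add0r.
  rewrite F0 subr0 dFE mul0r add0r mul1r => hk.
  have hk' : `|F (h t, k + t) - k * b| <= `|k|.
    apply: le_trans (hk _) _; first by near: k; exact: near_norm.
    by apply: pair_norm_le; rewrite ?normr0.
  rewrite /K mulrAC ler_pdivlMr// mulrC.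
  apply: le_trans (Fl _ _ (k + t)) _; rewrite F0 sub0r normrN.
  rewrite -[F _](subrK (k * b)) (le_trans (ler_normD _ _))//.
  by rewrite normrM mulrDl mul1r addrC lerD// mulrC.
rewrite /derivable; apply/cvg_ex; exists (- (b / a)).
apply/cvgrPdist_le => e e0.
(* The error is at most e1 (K + 1) |k|; division by |k a| leaves e. *)
pose e1 := e * `|a| / (K + 1).
have e10 : 0 < e1 by rewrite divr_gt0 ?mulr_gt0 ?normr_gt0// addr_gt0.
have [e' e'0 he] := pair_small _ (differentiable_estimate dF e10).
near=> k => /=.
have k0 : k != 0 by near: k; exact: nbhs_dnbhs_neq.
have lipk : `|h (k + t) - h t| <= K * `|k| by near: k; exact: (nbhs_dnbhs hlip).
set D := h (k + t) - h t in lipk.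
have := he (D, k) _ _.
have -> : (D, k) + (h t, t) = (h (k + t), k + t).
  by rewrite -[LHS]/(D + h t, k + t) /D subrK.
rewrite F0 F0 subrr sub0r dFE normrN => hk.
have {}hk : `|D * a + k * b| <= e1 * ((K + 1) * `|k|).
  apply: le_trans (hk _ _) _ => /=.
  - apply: le_lt_trans lipk _; rewrite -ltr_pdivlMl//.
    near: k; apply: nbhs_dnbhs; apply: near_norm; rewrite mulr_gt0 ?invr_gt0//.
  - near: k; apply: nbhs_dnbhs; exact: near_norm.
  rewrite ler_wpM2l ?(ltW e10)//; apply: pair_norm_le; rewrite mulrDl mul1r.
    by apply: (le_trans lipk); rewrite lerDl.
  by rewrite lerDr mulr_ge0// ltW.
rewrite /GRing.scale/= mulr1 -/D.
have -> : - (b / a) - k^-1 * D = - ((D * a + k * b) / (k * a)).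
  by field; rewrite k0 a0.
rewrite normrN normrM normfV normrM ler_pdivrMr ?mulr_gt0 ?normr_gt0//.
apply: (le_trans hk); rewrite /e1 mulrA divfK ?gt_eqF ?addr_gt0//.
by rewrite -mulrA (mulrC `|a|) lexx.
Unshelve. all: by end_near. Qed.

(** * Classical solutions along the flow *)

Section FlowSolution.
Variables (R : realType) (d : nat) (A : 'M[R]_d) (lam : R * R -> R).
Variables (lmin lmax L : R).
Hypothesis lmin_gt0 : 0 < lmin.
Hypothesis lam_bd : forall p, lmin <= lam p <= lmax.
Hypothesis lam_lip : forall t x y, `|lam (t, x) - lam (t, y)| <= L * `|x - y|.

(** The derivative along [a] is the one in direction (1, lam), hence zero. The end points may lie on
    the boundary of the strip, but [a] is strictly increasing, so the points between are interior
    and the mean value theorem applies to each coordinate. *)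
Lemma solution_constant u0 (u : R * R -> 'cV[R]_d) (a : R -> R) (r0 r1 : R) :
  classical_solution A lam u0 u -> is_characteristic lam a ->
  0 <= r0 -> r0 <= r1 -> 0 <= a r0 -> a r1 <= 1 -> u (r0, a r0) = u (r1, a r1).
Proof.
move=> sol ha r00; rewrite le_eqVlt => /predU1P[->//|r01] a0 a1.
have speed := characteristic_speed lam_bd ha.
have a_lt s r : s < r -> a s < a r.
  move=> sr; have /andP[h _] := speed s r (ltW sr).
  by rewrite -subr_gt0; apply: lt_le_trans h; rewrite mulr_gt0// subr_gt0.
have ain r : r0 <= r -> r <= r1 -> 0 <= a r <= 1.
  rewrite le_eqVlt => /predU1P[<-|r0r].
    by move=> _; rewrite a0 (le_trans _ a1)// ltW// a_lt.
  rewrite le_eqVlt => /predU1P[->|rr1].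
    by rewrite a1 (le_trans a0)// ltW// a_lt.
  apply/andP; split; first by rewrite (le_trans a0)// ltW// a_lt.
  by apply: le_trans a1; rewrite ltW// a_lt.
apply/matrixP => i j; rewrite (ord1 j).
pose g (r : R) : R := u (strip_clamp (r, a r)) i 0.
have gE r : r0 <= r -> r <= r1 -> g r = u (r, a r) i 0.
  by move=> h1 h2; rewrite /g strip_clampE; [|exact: le_trans h1|exact: ain].
have cg : {within `[r0, r1], continuous g}.
  apply: continuous_subspaceT => r.
  apply: (@continuous_comp _ _ _ (fun r => u (strip_clamp (r, a r))) (fun M : 'cV[R]_d => M i 0)).
    apply: (@continuous_comp _ _ _ (fun r => (r, a r)) (u \o @strip_clamp R)).
      apply: (cvg_pair (F := nbhs r) (G := nbhs r) (H := nbhs (a r)) (f := idfun) (g := a)).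
        exact: cvg_id.
      exact: (characteristic_continuous ha).
    exact: (solution_continuous sol).
  exact: coord_continuous.
have dg r : r \in `]r0, r1[ -> is_derive r 1 g 0.
  rewrite in_itv/= => /andP[h0 h1].
  have rp : 0 < r by exact: le_lt_trans h0.
  have ar : 0 < a r < 1.
    by rewrite (le_lt_trans a0) ?a_lt//= (lt_le_trans _ a1)// a_lt.
  have dc : is_derive r 1 (fun r => (r, a r)) (1, lam (r, a r)).
    by apply: is_derive_pair => //; exact: is_derive_id.
  have du := solution_differentiable sol rp ar.
  have d1 : is_derive r 1 (fun r => u (r, a r)) 0.
    rewrite -(solution_transport sol rp ar).
    exact: (@is_derive_comp_diff _ _ _ (fun r => (r, a r)) u r _ dc du).
  have d2 : is_derive r 1 (fun r => u (r, a r) i 0) 0.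
    have := @is_derive_comp_diff _ _ _ (fun r => u (r, a r)) (fun M : 'cV[R]_d => M i 0 : R)
      r _ d1 (differentiable_coord _ _ _).
    by rewrite linear0.
  apply: (near_eq_is_derive _ d2).
  near=> s; rewrite gE//; apply: ltW; near: s; [exact: lt_nbhsr|exact: lt_nbhsl].
have [c _] := MVT r01 dg cg.
by rewrite mul0r !gE ?lexx ?(ltW r01)// => /subr0_eq.
Unshelve. all: by end_near. Qed.

Variable Phi : R * R * R -> R.
Hypothesis flow : is_flow lam Phi.

Lemma flow_differentiable p : differentiable Phi p.
Proof. by case: flow => -[h _] _ _; exact: h. Qed.

Lemma flow_continuous : continuous Phi.
Proof. by move=> p; apply: differentiable_continuous; exact: flow_differentiable. Qed.

Lemma flow_is_derive_time (t t0 x0 : R) :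
  is_derive t (1 : R) (fun r => Phi (r, t0, x0)) ('d Phi (t, t0, x0) (1, 0, 0)).
Proof.
apply: (@is_derive_comp_diff _ _ _ (fun r => (r, t0, x0)) Phi); last exact: flow_differentiable.
by do 2! apply: is_derive_pair.
Qed.

Lemma flow_is_derive_start (t t0 x0 : R) :
  is_derive t0 (1 : R) (fun s => Phi (t, s, x0)) ('d Phi (t, t0, x0) (0, 1, 0)).
Proof.
apply: (@is_derive_comp_diff _ _ _ (fun s => (t, s, x0)) Phi); last exact: flow_differentiable.
by do 2! apply: is_derive_pair.
Qed.

Lemma flow_diff_time (t t0 x0 : R) :
  'd Phi (t, t0, x0) (1, 0, 0) = lam (t, Phi (t, t0, x0)).
Proof.
have [_ pf _] := flow; have [_ e] := flow_is_derive_time t t0 x0.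
by rewrite -e -derive1E pf.
Qed.

Lemma flow_characteristic (t0 x0 : R) :
  is_characteristic lam (fun r => Phi (r, t0, x0)).
Proof. by move=> r; rewrite -flow_diff_time; exact: flow_is_derive_time. Qed.

Lemma flow_start (t0 x0 : R) : Phi (t0, t0, x0) = x0.
Proof. by case: flow. Qed.

(* The value carried by the characteristic through (s, 0): u (s, 0) for s >= 0, and
   u (0, Phi (0, s, 0)) for s < 0 as long as Phi (0, s, 0) <= 1. *)
Definition boundary_trace (u : R * R -> 'cV[R]_d) (s : R) : 'cV[R]_d :=
  u (strip_clamp (Num.max 0 s, Phi (Num.max 0 s, s, 0))).

Lemma boundary_trace_continuous u0 u : classical_solution A lam u0 u ->
  continuous (boundary_trace u).
Proof.
move=> sol s.
have -> : boundary_trace u =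
  (u \o @strip_clamp R) \o (fun s => (Num.max 0 s, Phi (Num.max 0 s, s, 0))) by [].
apply: continuous_comp; last exact: (solution_continuous sol).
have cm : continuous (fun s : R => Num.max 0 s) by exact: continuous_maxl0.
have cP : continuous (Phi \o (fun s : R => (Num.max 0 s, s, 0))).
  move=> r; apply: continuous_comp; last exact: flow_continuous.
  apply: (cvg_pair (F := nbhs r) (G := nbhs (Num.max 0 r, r)) (H := nbhs (0 : R))
    (f := fun s => (Num.max 0 s, s)) (g := fun s => 0)); last exact: cvg_cst.
  apply: (cvg_pair (F := nbhs r) (G := nbhs (Num.max 0 r)) (H := nbhs r)
    (f := fun s => Num.max 0 s) (g := idfun)); [exact: cm|exact: cvg_id].
apply: (cvg_pair (F := nbhs s) (G := nbhs (Num.max 0 s)) (H := nbhs (Phi (Num.max 0 s, s, 0)))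
  (f := fun s => Num.max 0 s) (g := fun s => Phi (Num.max 0 s, s, 0))).
  exact: cm.
exact: cP.
Qed.

Lemma flow_ge0 (s r : R) : s <= r -> 0 <= Phi (r, s, 0).
Proof.
move=> sr; have /andP[h _] := characteristic_speed lam_bd (flow_characteristic s 0) sr.
by rewrite flow_start subr0 in h; apply: le_trans h; rewrite mulr_ge0 ?subr_ge0// ltW.
Qed.

(** From time max 0 s to time t the characteristic through (s, 0) stays in the strip, so u is
    constant on it. *)
Lemma boundary_traceE u0 u (t s : R) : classical_solution A lam u0 u ->
  0 <= t -> s <= t -> Phi (t, s, 0) <= 1 -> boundary_trace u s = u (t, Phi (t, s, 0)).
Proof.
move=> sol t0 st P1; rewrite /boundary_trace; set m := Num.max 0 s.
have m0 : 0 <= m by rewrite /m le_max lexx.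
have sm : s <= m by rewrite /m le_max lexx orbT.
have mt : m <= t by rewrite /m ge_max t0.
have mt' : Phi (m, s, 0) <= Phi (t, s, 0).
  have /andP[h _] := characteristic_speed lam_bd (flow_characteristic s 0) mt.
  by rewrite -subr_ge0; apply: le_trans h; rewrite mulr_ge0 ?subr_ge0// ltW.
rewrite strip_clampE//; last by rewrite flow_ge0//= (le_trans mt').
exact: (solution_constant sol (flow_characteristic s 0) m0 mt (flow_ge0 sm) P1).
Qed.

(** At time s' the earlier characteristic leads by the distance it has travelled, between lmin (s' -
    s) and lmax (s' - s); from then on the Gronwall bounds control the gap. *)
Lemma flow_gap_start (t s s' : R) : s < s' -> s' <= t ->
  lmin * (s' - s) * expR (- (L * (t - s'))) <= Phi (t, s, 0) - Phi (t, s', 0)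
    <= lmax * (s' - s) * expR (L * (t - s')).
Proof.
move=> ss' s't.
have ha := flow_characteristic s 0; have hb := flow_characteristic s' 0.
have /andP[h1 h2] := characteristic_speed lam_bd ha (ltW ss').
rewrite flow_start subr0 in h1 h2.
have P0 : 0 < Phi (s', s, 0) by apply: lt_le_trans h1; rewrite mulr_gt0// subr_gt0.
have := characteristic_gap lam_lip ha hb s't.
rewrite flow_start subr0 => /(_ P0) /andP[g1 g2].
apply/andP; split; first by apply: le_trans g1; rewrite ler_wpM2r ?expR_ge0.
by apply: (le_trans g2); rewrite ler_wpM2r ?expR_ge0.
Qed.

Variable Rt : R * R -> R.
Hypothesis origin : is_origin_time Phi Rt.
Let h (t : R) : R := Rt (t, 1).

Lemma flow_origin (t : R) : Phi (h t, t, 1) = 0.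
Proof. exact/origin. Qed.

Lemma origin_lt (t : R) : h t < t.
Proof.
rewrite ltNge; apply/negP => ht.
have /andP[+ _] := characteristic_speed lam_bd (flow_characteristic t 1) ht.
rewrite flow_origin flow_start sub0r leNgt => /negP; apply.
by rewrite (@lt_le_trans _ _ 0) ?ltrN10// mulr_ge0 ?subr_ge0// ltW.
Qed.

(** This is the longest time needed to cross [0, 1] at speed at least lmin. *)
Lemma origin_ge (t : R) : t - h t <= lmin^-1.
Proof.
have /andP[+ _] := characteristic_speed lam_bd (flow_characteristic t 1) (ltW (origin_lt t)).
by rewrite flow_origin flow_start subr0 -ler_pdivlMl// mulr1.
Qed.

(** [Rt] traces the characteristic through (t, 1) backwards; by uniqueness it is the one that leaves
    0 at time h t. *)
Lemma flow_from_origin (t : R) : Phi (t, h t, 0) = 1.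
Proof.
rewrite -[RHS](flow_start t 1).
apply: (characteristic_unique lam_lip (flow_characteristic (h t) 0)
  (flow_characteristic t 1) (ltW (origin_lt t))).
by rewrite flow_start flow_origin.
Qed.

Lemma boundary_trace_delay u0 u (t : R) : classical_solution A lam u0 u -> 0 <= t ->
  boundary_trace u t = A *m boundary_trace u (h t).
Proof.
move=> sol t0; have [_ _ _ bc _] := sol.
rewrite (boundary_traceE sol t0 (lexx _)) ?flow_start// bc//.
by rewrite (boundary_traceE sol t0 (ltW (origin_lt t))) flow_from_origin.
Qed.

(** [is_origin_time] states no regularity, so h is treated as the implicit function of Phi (r, t, 1)
    = 0; lam >= lmin gives both the lower Lipschitz bound in r and the nonzero partial
    derivative. *)
Lemma origin_derivable (t : R) : derivable h t 1.
Proof.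
pose F (p : R * R) := Phi (p.1, p.2, 1).
have dF p : differentiable F p.
  have -> : F = Phi \o (fun p : R * R => (p.1, p.2, 1)) by [].
  apply: differentiable_comp; last exact: flow_differentiable.
  apply: differentiable_pair; last exact: differentiable_cst.
  rewrite (_ : (fun y : R * R => (y.1, y.2)) = id); first by [].
  by apply/funext => -[].
apply: (@implicit_derivable _ F h t lmin) => //.
- by move=> s; exact: flow_origin.
- move=> r r' s /=.
  have H x y : x <= y -> lmin * `|y - x| <= `|Phi (y, s, 1) - Phi (x, s, 1)|.
    move=> xy; have /andP[h1 _] := characteristic_speed lam_bd (flow_characteristic s 1) xy.
    rewrite ger0_norm ?subr_ge0//; apply: (le_trans h1); exact: ler_norm.
  have [|/ltW] := leP r r' => rr'; last exact: H.
  by rewrite distrC [leRHS]distrC; exact: H.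
- have [_ e1] := is_derive_fst (dF (h t, t)).
  have [_ e2] := flow_is_derive_time (h t) t 1.
  rewrite -e1 e2 flow_diff_time gt_eqF//.
  by have /andP[l1 _] := lam_bd (h t, Phi (h t, t, 1)); exact: lt_le_trans l1.
Qed.

End FlowSolution.

(** * The delay equation and decay in L^p *)

(** The power is differentiable away from 0; at 0, |y|^p <= |y| for |y| <= 1 because p >= 1. *)
Lemma continuous_powR_norm (R : realType) (p : R) : 1 <= p ->
  continuous (fun x : R => `|x| `^ p).
Proof.
move=> p1 x; have [->|x0] := eqVneq x 0.
  have p0 : p != 0 by rewrite gt_eqF// (lt_le_trans ltr01).
  rewrite /continuous_at normr0 powR0//.
  apply/cvgrPdist_le => e e0; near=> y.
  rewrite sub0r normrN ger0_norm ?powR_ge0//.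
  have [->|y0] := eqVneq y 0.
    by rewrite normr0 powR0// ltW.
  apply: (@le_trans _ _ `|y|).
    apply: ge1r_powR => //; rewrite normr_gt0 y0/=.
    by near: y; apply/nbhs_ballP; exists 1; [exact: ltr01|move=> k];
      rewrite /ball/= sub0r normrN => /ltW.
  by near: y; apply/nbhs_ballP; exists e => // k; rewrite /ball/= sub0r normrN => /ltW.
apply: (@continuous_comp _ _ _ (fun x : R => `|x|) (fun x => x `^ p)).
  exact: norm_continuous.
apply: differentiable_continuous; apply/derivable1_diffP; apply: derivable_powR.
by rewrite in_itv/= normr_gt0 x0.
Unshelve. all: by end_near. Qed.

(** The base point is later taken strictly to the left of the interval in use, so that two-sided
    derivatives exist at its end points: -1 for [0, 1], and - lmin^-1 - 1 for [h t, t] with t >=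
    0. *)
Lemma antiderivative_exists (R : realType) (g : R -> R) (a : R) : continuous g ->
  exists W : R -> R, forall x : R, a < x -> is_derive x 1 W (g x).
Proof.
move=> cg; exists (fun x => (\int[lebesgue_measure]_(t in [set` `[a, x]]) (g t))%R) => x ax.
have xx : x < x + 1 by rewrite ltrDl.
have ig : lebesgue_measure.-integrable `[a, x + 1] (EFin \o g).
  apply: continuous_compact_integrable; first exact: segment_compact.
  exact: continuous_subspaceT.
have [d e] := continuous_FTC1_closed xx ig ax (cg x).
by apply: DeriveDef; [exact: d|rewrite -derive1E; exact: e].
Qed.

Section LpNorm.
Variables (R : realType) (d : nat) (N : 'cV[R]_d -> R) (p : R).
Hypotheses (N_norm : is_norm N) (p_ge1 : 1 <= p).

Lemma Lnorm01_antiderivative (v : R -> 'cV[R]_d) (f W : R -> R) :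
  continuous f -> (forall x, 0 <= x <= 1 -> f x = N (v x)) ->
  (forall x : R, -1 < x -> is_derive x 1 W (`|f x| `^ p)) ->
  0 <= W 1 - W 0 /\ Lp_norm01 N p%:E v = ((W 1 - W 0) `^ p^-1)%:E.
Proof.
move=> cf fv dW.
have p0 : 0 < p by exact: lt_le_trans p_ge1.
have cg : continuous (fun x => `|f x| `^ p).
  move=> x; apply: (@continuous_comp _ _ _ f (fun y => `|y| `^ p)); first exact: cf.
  exact: continuous_powR_norm.
have cW (x : R) : -1 < x -> {for x, continuous W}.
  move=> x1; have [h _] := dW x x1.
  by apply: differentiable_continuous; apply/derivable1_diffP.
have W01 : 0 <= W 1 - W 0.
  rewrite subr_ge0; apply: (@le_of_derive_ge0 _ W (fun x => `|f x| `^ p)) => //.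
  - by move=> x /andP[x0 _]; apply: dW; lra.
  - apply: continuous_in_subspaceT => x; rewrite inE/= in_itv/= => /andP[x0 _].
    by apply: cW; lra.
split=> //.
have FTC : (\int[lebesgue_measure]_(x in `[0%R, 1%R]) (`|f x| `^ p)%:E = (W 1)%:E - (W 0)%:E)%E.
  apply: (@continuous_FTC2 _ (fun x => `|f x| `^ p)) => //.
  - exact: continuous_subspaceT.
  - split.
    + by move=> x; rewrite in_itv/= => /andP[x0 _]; have [] := dW x (lt_trans (ltrN10 _) x0).
    + by apply: cvg_at_right_filter; apply: cW; lra.
    + by apply: cvg_at_left_filter; apply: cW; lra.
  - move=> x; rewrite in_itv/= => /andP[x0 _].
    by have [_ <-] := dW x (lt_trans (ltrN10 _) x0); rewrite derive1E.
rewrite /Lp_norm01 unlock -poweR_EFin; congr (_ `^ _)%E.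
rewrite EFinB -FTC [RHS]integral_mkcond; apply: eq_integral => x _ /=.
rewrite /patch; case: ifPn => xI.
  by rewrite /= fv//; move: xI; rewrite inE/= in_itv/=.
by rewrite normr0 powR0// gt_eqF.
Qed.
End LpNorm.

(** An existing derivative is determined by right difference quotients. This turns gap estimates for
    s < s' into Jacobian bounds. *)
Lemma derive_le_slope (R : realType) (f : R -> R) (s t D K : R) :
  is_derive s 1 f D -> s < t ->
  (forall s', s < s' -> s' <= t -> f s' - f s <= K * (s' - s)) -> D <= K.
Proof.
move=> [df <-] st fK.
have h : (k^-1 *: (f (k *: 1 + s) - f s) @[k --> 0^'+] --> 'D_1 f s).
  by apply: cvg_dnbhs_at_right; exact: df.
apply: (cvgr_to_le h); near=> k.
have k0 : 0 < k by near: k; exact: nbhs_right_gt.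
rewrite /GRing.scale/= mulr1 ler_pdivrMl// mulrC (_ : K * k = K * (k + s - s)); last by ring.
apply: fK; first by rewrite ltrDr.
rewrite -lerBrDr; near: k; apply: nbhs_right_le; by rewrite subr_gt0.
Unshelve. all: by end_near. Qed.

Lemma derive_ge_slope (R : realType) (f : R -> R) (s t D K : R) :
  is_derive s 1 f D -> s < t ->
  (forall s', s < s' -> s' <= t -> K * (s' - s) <= f s' - f s) -> K <= D.
Proof.
move=> df st fK; rewrite -lerN2.
apply: (@derive_le_slope _ (fun x => - f x) s t) => //.
by move=> s' ss' s't; rewrite mulNr -opprD lerN2 fK.
Qed.

(** V - K W is nonincreasing. This stands in for monotonicity of the integral and, when one
    antiderivative is composed with the flow, for the change of variables. *)
Lemma antiderivative_le (R : realType) (f g V W : R -> R) (a b K : R) : a <= b ->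
  (forall x : R, a <= x <= b -> is_derive x 1 V (f x)) ->
  (forall x : R, a <= x <= b -> is_derive x 1 W (g x)) ->
  (forall x, a < x < b -> f x <= K * g x) ->
  V b - V a <= K * (W b - W a).
Proof.
move=> ab dV dW fg.
have dk (x : R) : a <= x <= b -> is_derive x 1 (fun y => V y - K * W y) (f x - K * g x).
  by move=> xab; apply: (is_deriveB (dV x xab)); exact: (is_deriveZ K (dW x xab)).
have : V b - K * W b <= V a - K * W a.
  apply: (@le_of_derive_le0 _ (fun y => V y - K * W y) (fun x => f x - K * g x)) => //.
  - by move=> x /andP[x1 x2]; apply: dk; rewrite !ltW.
  - by move=> x xab; rewrite subr_le0 fg.
  - apply: continuous_in_subspaceT => x; rewrite inE/= in_itv/= => xab.
    have [h _] := dk x xab.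
    by apply: differentiable_continuous; apply/derivable1_diffP.
by rewrite mulrBr; lra.
Qed.

(** * The energy of the boundary trace *)

Section DelayEnergy.
Variables (R : realType) (d : nat) (A : 'M[R]_d) (lam : R * R -> R).
Variables (lmin lmax L : R).
Hypothesis lmin_gt0 : 0 < lmin.
Hypothesis L_gt0 : 0 < L.
Hypothesis lam_bd : forall p, lmin <= lam p <= lmax.
Hypothesis lam_lip : forall t x y, `|lam (t, x) - lam (t, y)| <= L * `|x - y|.
Variables (Phi : R * R * R -> R) (Rt : R * R -> R) (alpha p q gamma : R).
Hypothesis flow : is_flow lam Phi.
Hypothesis origin : is_origin_time Phi Rt.
Hypothesis delay_le : forall t : R, derive1 (delay Rt) t <= alpha.
Hypothesis p_ge1 : 1 <= p.
Variable M : 'cV[R]_d -> R.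
Hypothesis M_cont : continuous M.
Hypothesis M_ge0 : forall v, 0 <= M v.
Hypothesis M_contr : forall v, M (A *m v) <= q * M v.
Hypothesis q_ge0 : 0 <= q.
Hypothesis gamma_gt0 : 0 < gamma.
Hypothesis q_gamma : q `^ p * expR (gamma * lmin^-1) <= 1 - alpha.
Variables (u0 : R -> 'cV[R]_d) (u : R * R -> 'cV[R]_d).
Hypothesis sol : classical_solution A lam u0 u.

Let h (t : R) : R := Rt (t, 1).
Let F (s : R) : R := `|M (boundary_trace Phi u s)| `^ p.
Let f (s : R) : R := expR (gamma * s) * F s.
Let y := boundary_trace Phi u.

Lemma origin_derive_ge (t : R) : 1 - alpha <= derive1 h t.
Proof.
have dh : derivable h t 1 by exact: (origin_derivable lmin_gt0 lam_bd flow origin).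
have := delay_le t.
have -> : derive1 (delay Rt) t = 1 - derive1 h t.
  rewrite !derive1E.
  have := is_deriveB (is_derive_id t (1 : R)) (derivableP dh).
  by case=> _.
by lra.
Qed.

Lemma weighted_trace_ge0 (s : R) : 0 <= f s.
Proof. by rewrite mulr_ge0 ?expR_ge0 ?powR_ge0. Qed.

Lemma weighted_trace_continuous : continuous f.
Proof.
have cF : continuous F.
  move=> s; apply: (@continuous_comp _ _ _ (M \o y) (fun x : R => `|x| `^ p)).
    apply: continuous_comp; last exact: M_cont.
    exact: (boundary_trace_continuous flow sol).
  exact: continuous_powR_norm.
move=> s; apply: cvgM; last exact: cF.
apply: continuous_comp; last exact: continuous_expR.
by apply: cvgM; [exact: cvg_cst|exact: cvg_id].
Qed.

(** One crossing contributes the factor q^p, while the weight grows by e^(gamma (t - h t)) <=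
    e^(gamma / lmin); the product is at most 1 - alpha, hence at most h' t. *)
Lemma weighted_trace_contr (t : R) : 0 <= t -> f t <= f (h t) * derive1 h t.
Proof.
move=> t0.
have hd := origin_derive_ge t.
have hr : 0 <= f (h t) by exact: weighted_trace_ge0.
have hg := origin_ge lmin_gt0 lam_bd flow origin t.
apply: (@le_trans _ _ (f (h t) * (1 - alpha))); last by rewrite ler_wpM2l.
apply: (@le_trans _ _ (f (h t) * (q `^ p * expR (gamma * lmin^-1)))); last by rewrite ler_wpM2l.
have FM : F t <= q `^ p * F (h t).
  rewrite /F (boundary_trace_delay lmin_gt0 lam_bd lam_lip flow origin sol t0).
  rewrite !ger0_norm// -powRM//.
  by apply: ge0_ler_powR; rewrite ?nnegrE ?mulr_ge0// (le_trans ler01).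
apply: (@le_trans _ _ (expR (gamma * t) * (q `^ p * F (h t)))).
  by rewrite /f ler_wpM2l ?expR_ge0.
rewrite /f (_ : gamma * t = gamma * h t + gamma * (t - h t)); last by ring.
rewrite expRD.
set X := expR (gamma * h t); set Y := q `^ p; set Z := F (h t).
rewrite (_ : X * _ * (Y * Z) = X * Z * (Y * expR (gamma * (t - h t)))); last by ring.
rewrite ler_wpM2l ?mulr_ge0 ?expR_ge0 ?powR_ge0// ler_wpM2l ?powR_ge0// ler_expR.
by rewrite ler_wpM2l// ltW.
Qed.

Variable P : R -> R.
Hypothesis P_derive : forall s : R, - lmin^-1 - 1 < s -> is_derive s 1 P (f s).

Let h_gt (t : R) : 0 <= t -> - lmin^-1 - 1 < h t.
Proof. by move=> t0; have := origin_ge lmin_gt0 lam_bd flow origin t; rewrite -/(h t); lra. Qed.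

(** The derivative of the left side is f t - f (h t) h' t, nonpositive by [weighted_trace_contr]. *)
Lemma energy_nonincreasing (t : R) : 0 <= t -> P t - P (h t) <= P 0 - P (h 0).
Proof.
move=> t0.
have l0 : 0 < lmin^-1 by rewrite invr_gt0.
have dE (x : R) : 0 <= x -> is_derive x 1 (fun x => P x - P (h x)) (f x - f (h x) * derive1 h x).
  move=> x0; have dh : is_derive x 1 h ('D_1 h x).
    by apply/derivableP; exact: (origin_derivable lmin_gt0 lam_bd flow origin).
  apply: is_deriveB; first by apply: P_derive; lra.
  rewrite derive1E; exact: (is_derive1_comp (P_derive (h_gt x0)) dh).
apply: (@le_of_derive_le0 _ (fun x => P x - P (h x)) (fun x => f x - f (h x) * derive1 h x) 0 t t0).
- by move=> x /andP[x0 _]; apply: dE; exact: ltW.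
- by move=> x /andP[x0 _]; rewrite subr_le0; apply: weighted_trace_contr; exact: ltW.
- apply: continuous_in_subspaceT => x; rewrite inE/= in_itv/= => /andP[x0 _].
  have [k _] := dE x x0.
  by apply: differentiable_continuous; apply/derivable1_diffP.
Qed.

(** In this range t - s <= lmin^-1, which makes the exponential factors of the gap estimate uniform
    in t. The sign is negative because a later start stays further behind. *)
Lemma flow_start_slope (t s : R) : h t < s < t ->
  - (lmax * expR (L / lmin)) <= 'd Phi (t, s, 0) (0, 1, 0) <= - (lmin * expR (- (L / lmin))).
Proof.
move=> /andP[hs st].
have hg := origin_ge lmin_gt0 lam_bd flow origin t; rewrite -/(h t) in hg.
have gap s' : s < s' -> s' <= t ->
    lmin * expR (- (L / lmin)) * (s' - s) <= Phi (t, s, 0) - Phi (t, s', 0)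
      <= lmax * expR (L / lmin) * (s' - s).
  move=> ss' s't.
  have /andP[g1 g2] := flow_gap_start lmin_gt0 lam_bd lam_lip flow ss' s't.
  have lmax0 : 0 <= lmax.
    by have /andP[a b] := lam_bd (0, 0); apply: le_trans b; apply: le_trans a; exact: ltW.
  have tL : L * (t - s') <= L / lmin by rewrite ler_wpM2l ?(ltW L_gt0)//; lra.
  apply/andP; split.
    apply: le_trans g1; rewrite mulrAC ler_wpM2l ?mulr_ge0 ?subr_ge0 ?(ltW ss') ?(ltW lmin_gt0)//.
    by rewrite ler_expR lerN2.
  apply: (le_trans g2); rewrite [leRHS]mulrAC ler_wpM2l ?mulr_ge0 ?subr_ge0 ?(ltW ss')//.
  by rewrite ler_expR.
have dP := flow_is_derive_start flow t s 0.
apply/andP; split.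
  apply: (derive_ge_slope dP st) => s' ss' s't.
  by have /andP[_ g] := gap s' ss' s't; rewrite mulNr; lra.
apply: (derive_le_slope dP st) => s' ss' s't.
by have /andP[g _] := gap s' ss' s't; rewrite mulNr; lra.
Qed.

Section Compare.
Variables (t : R) (W : R -> R).
Hypothesis t_ge0 : 0 <= t.
Hypothesis W_derive : forall x : R, -1 < x ->
  is_derive x 1 W (`|M (u (strip_clamp (t, x)))| `^ p).

(** Here s = h t corresponds to x = 1 and s = t to x = 0; this reversal of orientation causes the
    minus signs below. *)
Let Wchi (s : R) : R := W (Phi (t, s, 0)).

Let chi_range (s : R) : h t <= s <= t -> 0 <= Phi (t, s, 0) <= 1.
Proof.
move=> /andP[hs st]; rewrite (flow_ge0 lmin_gt0 lam_bd flow st)/=.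
move: hs; rewrite le_eqVlt => /predU1P[<-|hs].
  by rewrite (flow_from_origin lmin_gt0 lam_bd lam_lip flow origin).
have /andP[g _] := flow_gap_start lmin_gt0 lam_bd lam_lip flow hs st.
rewrite -(flow_from_origin lmin_gt0 lam_bd lam_lip flow origin t) -subr_ge0.
apply: le_trans g; rewrite mulr_ge0 ?expR_ge0// mulr_ge0 ?subr_ge0 ?(ltW hs)//; exact: ltW.
Qed.

Let Wchi_derive (s : R) : h t <= s <= t ->
  is_derive s 1 Wchi (F s * 'd Phi (t, s, 0) (0, 1, 0)).
Proof.
move=> hst; have /andP[c0 c1] := chi_range hst; have /andP[hs st] := hst.
have d1 := W_derive (lt_le_trans (ltrN10 R) c0).
have := is_derive1_comp d1 (flow_is_derive_start flow t s 0).
by rewrite strip_clampE ?c0// /F (boundary_traceE lmin_gt0 lam_bd flow sol t_ge0 st c1).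
Qed.

Let P_derive' (s : R) : h t <= s <= t -> is_derive s 1 P (f s).
Proof. by move=> /andP[hs _]; apply: P_derive; apply: lt_le_trans hs; exact: h_gt. Qed.

(** On [h t, t] the weight is at least e^(gamma (t - 1/lmin)), and the Jacobian is at most lmax
    e^(L/lmin) in absolute value. *)
Lemma energy_upper :
  W 1 - W 0 <= lmax * expR (L / lmin) * expR (- (gamma * (t - lmin^-1))) * (P t - P (h t)).
Proof.
have ht : h t <= t by exact: ltW (origin_lt lmin_gt0 lam_bd flow origin t).
have hg := origin_ge lmin_gt0 lam_bd flow origin t; rewrite -/(h t) in hg.
set K := lmax * _ * _.
have : Wchi (h t) - Wchi t <= K * (P t - P (h t)).
  have := @antiderivative_le _ (fun s => - (F s * 'd Phi (t, s, 0) (0, 1, 0))) f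
    (fun s => - Wchi s) P (h t) t K ht _ P_derive' _.
  rewrite opprK addrC; apply.
    by move=> s hst; exact: is_deriveN (Wchi_derive hst).
  move=> s hst; have /andP[hs st] := hst.
  have /andP[d1 _] := flow_start_slope hst.
  have F0 : 0 <= F s by exact: powR_ge0.
  have lmax0 : 0 <= lmax.
    by have /andP[a b] := lam_bd (0, 0); apply: le_trans b; apply: le_trans a; exact: ltW.
  apply: (@le_trans _ _ (F s * (lmax * expR (L / lmin)))).
    by rewrite -mulrN ler_wpM2l// lerNl.
  rewrite /K /f (_ : _ * _ * _ * (_ * F s) = F s * (lmax * expR (L / lmin)) *
     (expR (- (gamma * (t - lmin^-1))) * expR (gamma * s))); last by ring.
  rewrite -expRD ler_peMr ?mulr_ge0 ?expR_ge0// -expR0 ler_expR.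
  rewrite (_ : _ + _ = gamma * (s - (t - lmin^-1))); last by ring.
  by rewrite mulr_ge0 ?(ltW gamma_gt0)//; lra.
by rewrite /Wchi (flow_from_origin lmin_gt0 lam_bd lam_lip flow origin) (flow_start flow).
Qed.

(** On [h t, t] the weight is at most e^(gamma t), and the Jacobian is at least lmin e^(- L/lmin) in
    absolute value. At t = 0 this bounds the initial energy by the initial data. *)
Lemma energy_lower :
  lmin * expR (- (L / lmin)) * expR (- (gamma * t)) * (P t - P (h t)) <= W 1 - W 0.
Proof.
have ht : h t <= t by exact: ltW (origin_lt lmin_gt0 lam_bd flow origin t).
set K := lmin * _ * _.
have K0 : 0 < K by rewrite !mulr_gt0 ?expR_gt0.
rewrite -ler_pdivlMl//.
have -> : W 1 - W 0 = - Wchi t - - Wchi (h t).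
  rewrite /Wchi (flow_from_origin lmin_gt0 lam_bd lam_lip flow origin) (flow_start flow).
  by rewrite opprK addrC.
apply: (@antiderivative_le _ f (fun s => - (F s * 'd Phi (t, s, 0) (0, 1, 0))) P
  (fun s => - Wchi s) (h t) t K^-1 ht P_derive').
  by move=> s hst; exact: is_deriveN (Wchi_derive hst).
move=> s hst; have /andP[hs st] := hst.
have /andP[_ d1] := flow_start_slope hst.
have F0 : 0 <= F s by exact: powR_ge0.
rewrite ler_pdivlMl// -mulrN.
apply: (@le_trans _ _ (F s * (lmin * expR (- (L / lmin))))); last first.
  by rewrite ler_wpM2l// lerNr.
rewrite /K /f (_ : _ * _ * _ * (_ * F s) = F s * (lmin * expR (- (L / lmin))) *
     (expR (- (gamma * t)) * expR (gamma * s))); last by ring.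
rewrite -expRD ler_piMr ?mulr_ge0 ?expR_ge0 ?(ltW lmin_gt0)// -expR0 ler_expR.
rewrite (_ : _ + _ = gamma * (s - t)); last by ring.
by rewrite mulr_ge0_le0 ?(ltW gamma_gt0)// subr_le0 ltW.
Qed.
End Compare.
End DelayEnergy.

Section LpDecay.
Variables (R : realType) (d : nat) (N : 'cV[R]_d -> R).
Variables (A : 'M[R]_d) (lam : R * R -> R) (lmin lmax L : R).
Hypotheses (d_gt0 : (0 < d)%N) (N_norm : is_norm N).
Hypothesis lmin_gt0 : 0 < lmin.
Hypothesis L_gt0 : 0 < L.
Hypothesis lam_bd : forall p, lmin <= lam p <= lmax.
Hypothesis lam_lip : forall t x y, `|lam (t, x) - lam (t, y)| <= L * `|x - y|.
Variables (Phi : R * R * R -> R) (Rt : R * R -> R) (alpha p : R).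
Hypothesis flow : is_flow lam Phi.
Hypothesis origin : is_origin_time Phi Rt.
Hypothesis delay_le : forall t : R, derive1 (delay Rt) t <= alpha.
Hypothesis p_ge1 : 1 <= p.
Hypothesis rho_lt : spectral_radius A `^ p < 1 - alpha.

Lemma contraction_rate : exists q, [/\ 0 < q, spectral_radius A < q & q `^ p < 1 - alpha].
Proof.
have p0 : 0 < p by exact: lt_le_trans p_ge1.
have rho0 := spectral_radius_ge0 A d_gt0.
(* Midpoint of the strict inequality between p-th powers; q is its p-th root. *)
set m := (spectral_radius A `^ p + (1 - alpha)) / 2.
have r0 : 0 <= spectral_radius A `^ p by exact: powR_ge0.
have m1 : spectral_radius A `^ p < m by exact: (midf_lt rho_lt).1.
have m2 : m < 1 - alpha by exact: (midf_lt rho_lt).2.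
have m0 : 0 < m by exact: le_lt_trans m1.
exists (m `^ p^-1); split.
- exact: powR_gt0.
- rewrite -[ltLHS]powRr1// -(mulfV (lt0r_neq0 p0)) powRrM.
  by apply: gt0_ltr_powR; rewrite ?invr_gt0 ?nnegrE ?(ltW m0).
- by rewrite -powRrM mulVf ?lt0r_neq0// powRr1// ltW.
Qed.

Lemma Lp_decay : exists C gamma : R, [/\ 0 < C, 0 < gamma &
  forall (u0 : R -> 'cV[R]_d) (u : R * R -> 'cV[R]_d),
    classical_solution A lam u0 u ->
    forall t : R, 0 <= t ->
      (Lp_norm01 N p%:E (fun x => u (t, x))
        <= (C * expR (- gamma * t))%:E * Lp_norm01 N p%:E u0)%E].
Proof.
have p0 : 0 < p by exact: lt_le_trans p_ge1.
have [q [q0 rq qp]] := contraction_rate.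
have [I [r [r0 rA]]] := adapted_form d_gt0 rq.
have [c [C [c0 C0 cC]]] := sumsq_norm_equiv d_gt0 N_norm r0.
pose M v := Num.sqrt (sumsq r v).
have M_cont : continuous M.
  move=> v; apply: continuous_comp; first exact: continuous_sumsq.
  exact: sqrt_continuous.
have M_ge0 v : 0 <= M v by exact: sqrtr_ge0.
have M_contr v : M (A *m v) <= q * M v.
  rewrite /M -(ger0_norm (ltW q0)) -sqrtr_sqr -sqrtrM ?sqr_ge0//.
  by rewrite ler_wsqrtr.
have qp0 : 0 < q `^ p by exact: powR_gt0.
have [gamma g0 qg] : exists2 gamma, 0 < gamma & q `^ p * expR (gamma * lmin^-1) <= 1 - alpha.
  (* The solution of q^p e^(gamma / lmin) = 1 - alpha, positive since q^p < 1 - alpha. *)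
  exists (lmin * ln ((1 - alpha) / q `^ p)).
    by rewrite mulr_gt0// ln_gt0// ltr_pdivlMr// mul1r.
  rewrite mulrAC divff ?gt_eqF// mul1r lnK; last first.
    by rewrite posrE divr_gt0// (lt_trans qp0).
  by rewrite mulrCA divff ?gt_eqF// mulr1.
have lmax0 : 0 < lmax.
  by have /andP[a b] := lam_bd (0, 0); apply: lt_le_trans b; exact: lt_le_trans a.
(* The factors, in order: from N to M at time t, from u(t, .) to the energy at time t, from the
   energy at time 0 to the initial data, and from M back to N. *)
pose K := c^-1 `^ p * (lmax * expR (L / lmin) * expR (gamma / lmin)) *
  (lmin * expR (- (L / lmin)))^-1 * C `^ p.
have K0 : 0 < K by rewrite !mulr_gt0 ?invr_gt0 ?powR_gt0 ?invr_gt0 ?mulr_gt0 ?expR_gt0.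
(* K and gamma govern p-th powers of the norms, hence the p-th root and the division by p. *)
exists (K `^ p^-1), (gamma / p); split; [exact: powR_gt0|exact: divr_gt0|].
move=> u0 u sol t t0; have [_ _ _ _ ic] := sol.
pose NU (s x : R) := N (u (strip_clamp (s, x))).
have cU s : continuous (fun x => u (strip_clamp (s, x))).
  exact: (continuous_curry_snd (G := u \o @strip_clamp R) (t := s) (solution_continuous sol)).
have cNU s : continuous (NU s).
  move=> x; apply: (@continuous_comp _ _ _ (fun x => u (strip_clamp (s, x))) N); first exact: cU.
  exact: is_norm_continuous.
have cMU s : continuous (fun x => M (u (strip_clamp (s, x)))).
  move=> x; apply: (@continuous_comp _ _ _ (fun x => u (strip_clamp (s, x))) M); first exact: cU.
  exact: M_cont.
have cpow (g : R -> R) : continuous g -> continuous (fun x => `|g x| `^ p).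
  move=> cg x; apply: (@continuous_comp _ _ _ g (fun x => `|x| `^ p)); first exact: cg.
  exact: continuous_powR_norm.
have [V1 dV1] := antiderivative_exists (-1) (cpow _ (cNU t)).
have [V0 dV0] := antiderivative_exists (-1) (cpow _ (cNU 0)).
have [W1 dW1] := antiderivative_exists (-1) (cpow _ (cMU t)).
have [W0 dW0] := antiderivative_exists (-1) (cpow _ (cMU 0)).
have [P dP] := antiderivative_exists (- lmin^-1 - 1)
  (weighted_trace_continuous (gamma := gamma) flow p_ge1 M_cont sol).
have N1E x : 0 <= x <= 1 -> NU t x = N (u (t, x)) by move=> x01; rewrite /NU strip_clampE.
have N0E x : 0 <= x <= 1 -> NU 0 x = N (u0 x).
  by move=> x01; rewrite /NU strip_clampE// ic.
have [V1p ->] := Lnorm01_antiderivative p_ge1 (cNU t) N1E dV1.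
have [V0p ->] := Lnorm01_antiderivative p_ge1 (cNU 0) N0E dV0.
have in01 (x : R) : 0 <= x <= 1 -> -1 < x.
  by move=> /andP[x0 _]; exact: lt_le_trans x0.
have VW : V1 1 - V1 0 <= c^-1 `^ p * (W1 1 - W1 0).
  apply: (antiderivative_le ler01 (fun x xI => dV1 x (in01 x xI)) (fun x xI => dW1 x (in01 x xI))).
  move=> x _; rewrite -powRM ?invr_ge0 ?(ltW c0)//.
  apply: ge0_ler_powR; rewrite ?nnegrE ?mulr_ge0 ?invr_ge0 ?(ltW c0) ?(ltW p0)//.
  rewrite !ger0_norm ?M_ge0 ?is_norm_ge0// ler_pdivlMl//.
  by have /andP[] := cC (u (strip_clamp (t, x))).
have WV : W0 1 - W0 0 <= C `^ p * (V0 1 - V0 0).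
  apply: (antiderivative_le ler01 (fun x xI => dW0 x (in01 x xI)) (fun x xI => dV0 x (in01 x xI))).
  move=> x _; rewrite -powRM ?(ltW C0)//.
  apply: ge0_ler_powR; rewrite ?nnegrE ?mulr_ge0 ?(ltW C0) ?(ltW p0)//.
  rewrite !ger0_norm ?M_ge0 ?is_norm_ge0//.
  by have /andP[] := cC (u (strip_clamp (0, x))).
have up := energy_upper lmin_gt0 L_gt0 lam_bd lam_lip flow origin g0 sol dP t0 dW1.
have lo := energy_lower lmin_gt0 L_gt0 lam_bd lam_lip flow origin g0 sol dP (lexx 0) dW0.
have en := energy_nonincreasing lmin_gt0 lam_bd lam_lip flow origin delay_le p_ge1
  M_ge0 M_contr (ltW q0) g0 qg sol dP t0.
have key : V1 1 - V1 0 <= K * expR (- (gamma * t)) * (V0 1 - V0 0).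
  apply: (le_trans VW); rewrite /K -!mulrA ler_wpM2l ?powR_ge0//.
  apply: (le_trans up).
  move: lo; rewrite mulr0 oppr0 expR0 mulr1 -ler_pdivlMl; last by rewrite mulr_gt0 ?expR_gt0.
  move=> lo.
  have {}en := le_trans en (le_trans lo (ler_wpM2l _ WV)).
  apply: (le_trans (ler_wpM2l _ (en _))).
  - by rewrite !mulr_ge0 ?expR_ge0// ltW.
  - by rewrite invr_ge0 mulr_ge0 ?expR_ge0// ltW.
  rewrite (_ : - (gamma * (t - lmin^-1)) = gamma / lmin + - (gamma * t)); last by ring.
  by rewrite expRD le_eqVlt; apply/orP; left; apply/eqP; ring.
rewrite -EFinM lee_fin.
have Ke0 : 0 <= K * expR (- (gamma * t)) by apply: mulr_ge0; [exact: ltW|exact: expR_ge0].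
have -> : K `^ p^-1 * expR (- (gamma / p) * t) = (K * expR (- (gamma * t))) `^ p^-1.
  rewrite powRM; [|exact: ltW|exact: expR_ge0].
  by rewrite -expRM; congr (_ * expR _); ring.
rewrite -powRM//; apply: ge0_ler_powR key; first by rewrite invr_ge0 ltW.
  by rewrite nnegrE.
by rewrite nnegrE; apply: mulr_ge0.
Qed.
End LpDecay.

Unset Implicit Arguments.

Theorem corollary6p8 (R : realType) (d : nat) (d_gt0 : (0 < d)%N)
    (N : 'cV[R]_d -> R) (N_norm : is_norm N)
    (A : 'M[R]_d) (lambda : R * R -> R)
    (A_lt1 : spectral_radius A < 1) (lambda_reg : lambda_regular lambda) :
  (exists C gamma : R, [/\ 0 < C, 0 < gamma &
     forall (u0 : R -> 'cV[R]_d) (u : R * R -> 'cV[R]_d),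
       classical_solution A lambda u0 u ->
       forall t : R, 0 <= t ->
         (Lp_norm01 N +oo (fun x => u (t, x))
            <= (C * expR (- gamma * t))%:E * Lp_norm01 N +oo u0)%E])
  /\
  (forall (Phi : R * R * R -> R) (Rt : R * R -> R) (alpha p : R),
     is_flow lambda Phi ->
     is_origin_time Phi Rt ->
     0 < alpha < 1 ->
     (forall t : R, derive1 (delay Rt) t <= alpha) ->
     1 <= p ->
     spectral_radius A `^ p < 1 - alpha ->
     exists C gamma : R, [/\ 0 < C, 0 < gamma &
       forall (u0 : R -> 'cV[R]_d) (u : R * R -> 'cV[R]_d),
         classical_solution A lambda u0 u ->
         forall t : R, 0 <= t ->
           (Lp_norm01 N p%:E (fun x => u (t, x))
              <= (C * expR (- gamma * t))%:E * Lp_norm01 N p%:E u0)%E]).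
Proof.
have [lmin [lmax [L [[l0 _ L0] [_ lbd dl _ lL]]]]] := lambda_reg.
split.
  apply: (Linfty_decay d_gt0 N_norm A_lt1 l0) => x.
  by have /andP[] := lbd x.
move=> Phi Rt alpha p flow origin _ delay_le p1 rho_lt.
exact: (Lp_decay d_gt0 N_norm l0 L0 lbd (fun t => lipschitz_of_derive (dl t) (lL t))
  flow origin delay_le p1 rho_lt).
Qed.
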